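(* Let $N\ge 2$ be an integer, let $m_0,m_0'\in L^\infty(\mathbb{T})$ be non-singular, and let $h,h'\in L^1(\mathbb{T})$ satisfy $h,h'\ge 0$, $R_{m_0,m_0}h=h$ and $R_{m_0',m_0'}h'=h'$. Let $(\pi,U,\mathcal{H},\varphi)$ be the cyclic representation associated to $h$ (and $m_0$), and let $(\pi',U',\mathcal{H}',\varphi')$ be the cyclic representation associated to $h'$ (and $m_0'$). Suppose $S:\mathcal{H}'\to\mathcal{H}$ is a bounded linear operator satisfying $$S\pi'(f)=\pi(f)S\quad (f\in L^\infty(\mathbb{T})),\qquad SU'=US.$$ Then there exists a unique $h_0\in L^1(\mathbb{T})$ such that $$R_{m_0,m_0'}h_0=h_0\qquad\text{and}\qquad \langle\varphi,S\pi'(f)\varphi'\rangle=\int_{\mathbb{T}}fh_0\,d\mu\quad(f\in L^\infty(\mathbb{T})).$$ Moreover $|h_0|^2\le\|S\|^2\,h\,h'$ almost everywhere on $\mathbb{T}$.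
   Context: $\mathbb{T}$ is the unit circle with normalized Haar measure $\mu$; $N\ge2$ is a fixed integer. A function $m\in L^\infty(\mathbb{T})$ is non-singular if it does not vanish on a subset of $\mathbb{T}$ of positive measure. Inner products are linear in the second variable and conjugate-linear in the first. For $m_0,m_0'\in L^\infty(\mathbb{T})$, the Ruelle transfer operator on $L^1(\mathbb{T})$ is $$R_{m_0,m_0'}f(z)=\frac1N\sum_{w^N=z}\overline{m_0(w)}\,m_0'(w)f(w).$$ Cyclic representation associated to $h$: given a non-singular $m_0\in L^\infty(\mathbb{T})$ and $h\in L^1(\mathbb{T})$, $h\ge0$, $R_{m_0,m_0}h=h$, it is a quadruple $(\pi,U,\mathcal{H},\varphi)$ where $\mathcal{H}$ is a Hilbert space, $\pi$ is a unital normal $*$-representation of $L^\infty(\mathbb{T})$ on $\mathcal{H}$, $U$ is a unitary on $\mathcal{H}$ with $U\pi(f)U^{-1}=\pi(f(z^N))$ for all $f\in L^\infty(\mathbb{T})$ (where $f(z^N)$ denotes $z\mapsto f(z^N)$), and $\varphi\in\mathcal{H}$ satisfies $U\varphi=\pi(m_0)\varphi$ and $\langle\varphi,\pi(f)\varphi\rangle=\int_{\mathbb{T}}fh\,d\mu$ for all $f\in L^\infty(\mathbb{T})$, and is cyclic, i.e. $\{U^{-n}\pi(f)\varphi : n\in\mathbb{N},\ f\in L^\infty(\mathbb{T})\}$ is dense in $\mathcal{H}$. Such a quadruple exists and is unique up to unitary equivalence (a known theorem of Jorgensen). For $m_0'$, $h'$ the definition is the same with $m_0',h'$ in place of $m_0,h$.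 *)

(* Defs.v *)
From HB Require Import structures.
From mathcomp Require Import all_boot all_order all_algebra.
From mathcomp Require Import complex.
From mathcomp Require Import all_classical all_reals all_analysis.
From mathcomp Require Import measurable_realfun.

Set Implicit Arguments.
Unset Strict Implicit.
Unset Printing Implicit Defensive.

Import Order.TTheory GRing.Theory Num.Theory.
Import numFieldNormedType.Exports.

Local Open Scope classical_set_scope.
Local Open Scope ring_scope.
Local Open Scope complex_scope.

(* Norms in R[i] and in complex normed spaces take values in R[i], and in R[i]
   [x <= y] means [Im x = Im y] and [Re x <= Re y].
   In particular [0 <= x] entails that [x] is real. *)

HB.mixin Record isHilbert (R : realType) H of CompleteNormedModule R[i] H := {
  ip : H -> H -> R[i];
  ip_linearr : forall (a : R[i]) (x y z : H),
    ip x (a *: y + z) = a * ip x y + ip x z;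
  ip_conj : forall x y : H, ip y x = (ip x y)^*;
  ip_norm : forall x : H, `|x| ^+ 2 = ip x x }.

#[short(type="hilbertType")]
HB.structure Definition Hilbert (R : realType) :=
  { H of isHilbert R H & CompleteNormedModule R[i] H }.

Definition bounded_op (R : realType) (H1 H2 : hilbertType R)
    (A : {linear H1 -> H2}) : Prop :=
  exists M : R, forall x, `|A x| <= M%:C * `|x|.

Definition opnorm (R : realType) (H1 H2 : hilbertType R)
    (A : {linear H1 -> H2}) : R :=
  sup [set complex.Re `|A x| | x in [set x : H1 | `|x| <= 1]].

(* [op_le A B] states that [B - A] is a positive operator. *)
Definition op_le (R : realType) (H : hilbertType R) (A B : {linear H -> H}) :=
  forall x : H, ip x (A x) <= ip x (B x).

Record unitary (R : realType) (H : hilbertType R) := Unitary {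
  unitary_fun :> {linear H -> H};
  unitary_inv : H -> H;
  unitary_ip : forall x y, ip (unitary_fun x) (unitary_fun y) = ip x y;
  unitary_funK : cancel unitary_fun unitary_inv;
  unitary_invK : cancel unitary_inv unitary_fun }.

Definition circle (R : realType) := {z : R[i] | `|z| == 1}.

HB.instance Definition _ (R : realType) := Choice.on (circle R).

Section circle.
Variable R : realType.

Fact circle1_subproof : `|1 : R[i]| == 1. Proof. by rewrite normr1. Qed.

HB.instance Definition _ :=
  isPointed.Build (circle R) (exist _ 1 circle1_subproof).

Fact circle_pow_subproof (N : nat) (z : circle R) : `|val z ^+ N| == 1.
Proof. by rewrite normrX (eqP (valP z)) expr1n. Qed.

Definition circle_pow (N : nat) (z : circle R) : circle R :=
  exist _ (val z ^+ N) (circle_pow_subproof N z).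

Definition circle_open : set (set (circle R)) :=
  [set val @^-1` O | O in [set O : set R[i]^o | open O]].

HB.instance Definition _ := @isMeasurable.Build (sigma_display circle_open)
  (circle R) <<s circle_open >> (@sigma_algebra0 _ setT circle_open)
  (@sigma_algebraC _ circle_open) (@sigma_algebra_bigcup _ setT circle_open).

Fact circle_exp_subproof (t : R) :
  `|cos (2 * pi * t) +i* sin (2 * pi * t)| == 1.
Proof. by rewrite normc_def /= cos2Dsin2 sqrtr1. Qed.

Definition circle_exp (t : R) : circle R :=
  exist (fun z : R[i] => `|z| == 1) _ (circle_exp_subproof t).

Lemma continuous_real_complex : continuous (fun t : R => t%:C : R[i]^o).
Proof.
move=> t; apply/cvgrPdist_lt => e e0.
have eE : e = (complex.Re e)%:C by rewrite RRe_real// gtr0_real.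
have r0 : 0 < complex.Re e by move: e0; rewrite eE ltcR.
near=> s; rewrite eE -rmorphB /= normc_def /= expr0n addr0 sqrtr_sqr ltcR.
near: s; have /cvgrPdist_lt := @cvg_id _ (nbhs t); exact.
Unshelve. all: by end_near. Qed.

Lemma measurable_circle_exp : measurable_fun setT circle_exp.
Proof.
apply: (measurability circle_open) => //.
move=> _ [_ [V /= openV <-] <-]; rewrite setTI; apply: open_measurable.
have cvgE : continuous (fun t : R => val (circle_exp t) : R[i]^o).
  have -> : (fun t : R => val (circle_exp t) : R[i]^o) =
      (fun t => (cos (2 * pi * t))%:C + 'i * (sin (2 * pi * t))%:C).
    by apply/funext => t; rewrite /= [LHS]complexE.
  have cl : continuous (fun t : R => 2 * pi * t).
    by move=> t; apply: cvgM; [exact: cvg_cst|exact: cvg_id].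
  move=> t; apply: (@cvgD _ R[i]^o); last apply: (@cvgM R[i]^o _ _ _ (cst 'i)).
  - apply: (continuous_comp (g := fun t : R => t%:C : R[i]^o)).
      by apply: continuous_comp; [exact: cl|exact: continuous_cos].
    exact: continuous_real_complex.
  - exact: cvg_cst.
  - apply: (continuous_comp (g := fun t : R => t%:C : R[i]^o)).
      by apply: continuous_comp; [exact: cl|exact: continuous_sin].
    exact: continuous_real_complex.
exact: (open_comp (f := fun t : R => val (circle_exp t) : R[i]^o)).
Qed.

(* Normalized arc length: the image of Lebesgue measure on [0, 1[ under
   t |-> exp (2 pi i t). *)
Definition haar : set (circle R) -> \bar R :=
  pushforward
    (mrestr (@lebesgue_measure R) (measurable_itv `[0, 1[)) circle_exp.

Let haar0 : haar set0 = 0%E.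
Proof. by rewrite /haar /pushforward preimage_set0 measure0. Qed.

Let haar_ge0 A : (0 <= haar A)%E.
Proof. by rewrite /haar /pushforward. Qed.

Let haar_sigma_additive : semi_sigma_additive haar.
Proof.
have mE B : measurable B -> measurable (circle_exp @^-1` B).
  by move=> mB; rewrite -[X in measurable X]setTI; exact: measurable_circle_exp.
move=> F mF tF mUF; rewrite /haar /pushforward preimage_bigcup.
apply: measure_semi_sigma_additive => [n||]; first exact: mE.
- apply/trivIsetP => /= i j _ _ ij; rewrite -preimage_setI.
  by move/trivIsetP : tF => /(_ _ _ _ _ ij) ->//; rewrite preimage_set0.
- by rewrite -preimage_bigcup; exact: mE.
Qed.

HB.instance Definition _ :=
  isMeasure.Build _ _ _ haar haar0 haar_ge0 haar_sigma_additive.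

Let haar_setT : haar setT = 1%E.
Proof.
rewrite /haar /pushforward /mrestr preimage_setT setTI lebesgue_measure_itv/=.
by rewrite lte_fin ltr01 -EFinD subr0.
Qed.

HB.instance Definition _ := Measure_isProbability.Build _ _ _ haar haar_setT.

End circle.

Arguments haar : clear implicits.

Section function_spaces.
Variable R : realType.
Implicit Types f g m : circle R -> R[i].

Definition cmeasurable f :=
  measurable_fun setT (fun z => complex.Re (f z)) /\
  measurable_fun setT (fun z => complex.Im (f z)).

(* Elements of L^oo and L^1 are given by representatives; equality in these
   spaces is [f = g %[ae haar R]]. *)
Definition Linfty : set (circle R -> R[i]) :=
  [set f | cmeasurable f /\
    exists M : R, \forall z \ae haar R, `|f z| <= M%:C].

Definition L1 : set (circle R -> R[i]) :=
  [set f | (haar R).-integrable setT (fun z => (complex.Re (f z))%:E) /\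
           (haar R).-integrable setT (fun z => (complex.Im (f z))%:E)].

Definition cintegral f : R[i] :=
  (\int[haar R]_z complex.Re (f z)) +i* (\int[haar R]_z complex.Im (f z)).

Definition ae_le f g := \forall z \ae haar R, f z <= g z.

Definition nonsingular m :=
  ~ exists A, [/\ measurable A, (0 < haar R A)%E & forall z, A z -> m z = 0].

Definition ruelle (N : nat) m m' f : circle R -> R[i] := fun z =>
  N%:R^-1 *
  \sum_(w \in [set w | circle_pow N w = z]) (m w)^* * m' w * f w.

End function_spaces.

(* [g] is a least upper bound of [D] among the elements of [X]. *)
Definition is_lub_in (T : Type) (le : T -> T -> Prop) (X D : set T) (g : T) :=
  [/\ X g, forall f, D f -> le f g &
      forall k, X k -> (forall f, D f -> le f k) -> le g k].

Section representations.
Variables (R : realType) (H : hilbertType R).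
Implicit Type pi : (circle R -> R[i]) -> {linear H -> H}.

(* Only the values of [pi] on [Linfty] matter; [rep_ae] makes it a map on
   almost everywhere classes. *)
Record is_unital_star_rep pi : Prop := {
  rep_bounded : forall f, Linfty f -> bounded_op (pi f);
  rep_ae : forall f g, Linfty f -> Linfty g -> f = g %[ae haar R] ->
    forall x, pi f x = pi g x;
  rep_linear : forall (a : R[i]) f g, Linfty f -> Linfty g ->
    forall x, pi (fun z => a * f z + g z) x = a *: pi f x + pi g x;
  rep_mul : forall f g, Linfty f -> Linfty g ->
    forall x, pi (fun z => f z * g z) x = pi f (pi g x);
  rep_star : forall f, Linfty f ->
    forall x y, ip x (pi (fun z => (f z)^*) y) = ip (pi f x) y;
  rep_unit : forall x, pi (cst 1) x = x }.

(* Normality: [pi] preserves least upper bounds of bounded upward directed sets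
   of positive elements (boundedness is implied by the existence of the least
   upper bound). *)
Definition is_normal_rep pi :=
  forall (D : set (circle R -> R[i])) (g : circle R -> R[i]),
    D !=set0 ->
    D `<=` [set f | Linfty f /\ ae_le (cst 0) f] ->
    (forall f1 f2, D f1 -> D f2 ->
      exists f, [/\ D f, ae_le f1 f & ae_le f2 f]) ->
    is_lub_in (@ae_le R) (@Linfty R) D g ->
    is_lub_in (@op_le R H) (@bounded_op R H H) (pi @` D) (pi g).

Record is_cyclic_rep (N : nat) (m0 h : circle R -> R[i])
    pi (U : unitary H) (phi : H) : Prop := {
  cyclic_star_rep : is_unital_star_rep pi;
  cyclic_normal : is_normal_rep pi;
  cyclic_covariant : forall f, Linfty f ->
    forall x, U (pi f (unitary_inv U x)) = pi (f \o circle_pow N) x;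
  cyclic_refine : U phi = pi m0 phi;
  cyclic_state : forall f, Linfty f ->
    ip phi (pi f phi) = cintegral (fun z => f z * h z);
  cyclic_dense : dense [set x | exists n f,
    Linfty f /\ x = iter n (unitary_inv U) (pi f phi)] }.

End representations.

(* Main.v *)
Require Import Defs.
From HB Require Import structures.
From mathcomp Require Import all_boot all_order all_algebra.
From mathcomp Require Import complex.
From mathcomp Require Import all_classical all_reals all_analysis.
From mathcomp Require Import measurable_realfun.
From mathcomp Require Import ring lra.

Set Implicit Arguments.
Unset Strict Implicit.
Unset Printing Implicit Defensive.

Import Order.TTheory GRing.Theory Num.Theory.
Import numFieldNormedType.Exports.

Local Open Scope classical_set_scope.
Local Open Scope ring_scope.
Local Open Scope complex_scope.

(** The statement rests on one inequality for the functional
[f |-> <phi, S pi'(f) phi'>], called [correlation] below. Since [S] intertwines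
the two representations,
[correlation (conj g * f) = <pi(g) phi, S pi'(f) phi'>], so
[2 |<x, y>| <= |x|^2 + |y|^2] and the formulas for the vector states of [phi]
and [phi'] give, for the real and the imaginary part ([correlation_bound]),
[2 |correlation (conj g * f)| <= \int |g|^2 h + |S|^2 \int |f|^2 h'].

Existence of [h0]. For [f = g] the indicator of [A], the inequality bounds the
set function [A |-> correlation 1_A] by the finite measure of density
[h + |S|^2 h']. It is therefore countably additive and absolutely continuous,
and the Radon-Nikodym theorem provides a density [h0]
([dominated_set_function_density]). Now [f |-> correlation f] and
[f |-> \int f h0] are linear, agree on indicators and are bounded on functions
with values in [[0, 1]]; writing such a function as the average of an
indicator and of another such function, again and again, shows that they are
equal ([linear_eq0_on_Linfty]). Uniqueness is uniqueness of a density, tested on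
indicators ([L1_ae_eq_indic]).

Ruelle equation. Unitarity of [U], [S U' = U S], [U phi = pi(m0) phi] and
covariance turn [correlation f] into
[correlation (conj m0 * m0' * f(z^N))] ([correlation_pow]). On the side of the
densities, [f |-> conj m0 * m0' * f(z^N)] is the transpose of the Ruelle
operator ([cintegral_ruelle]), because Haar measure is the average of its
images under the [N] inverse branches of [z |-> z^N] ([haar_branch]). So [h0]
and its image under the Ruelle operator have the same integral on every set.

Pointwise bound. Taking [g = s 1_A] and [f = 1_A * conj (sign h0)] in the basic
inequality gives [2 s \int_A |h0| <= s^2 \int_A h + |S|^2 \int_A h'] for all
[A], hence [2 s |h0| <= s^2 h + |S|^2 h'] almost everywhere for each real [s]
([density_scaled_bound]). Outside one null set this holds for all rational [s],
hence for all real [s], and the discriminant of this nonnegative quadratic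
polynomial in [s] yields [|h0|^2 <= |S|^2 h h']. *)

(** * Densities of dominated set functions *)

Section real_integration.
Context d (T : measurableType d) (R : realType).

Lemma integrable_ae_boundedM (mu : {measure set T -> \bar R}) (f g : T -> R)
    (M : R) :
  measurable_fun setT f -> (\forall x \ae mu, `|f x| <= M) ->
  mu.-integrable setT (EFin \o g) ->
  mu.-integrable setT (EFin \o (fun x => f x * g x)).
Proof.
move=> mf fM ig; have mg : measurable_fun setT g.
  by apply/measurable_EFinP; exact: measurable_int ig.
apply/integrableP; split; first by apply/measurable_EFinP/measurable_funM.
have igM : mu.-integrable setT (fun x => M%:E * (g x)%:E)%E.
  exact: integrableZl.
case/integrableP : igM => mMg; apply: le_lt_trans.
apply: ae_ge0_le_integral => //.
- by apply: measurableT_comp => //; apply/measurable_EFinP/measurable_funM.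
- exact: measurableT_comp.
apply: filterS fM => x fxM _ /=; rewrite lee_fin !normrM ler_wpM2r//.
exact: le_trans fxM (ler_norm _).
Qed.

(** Domination by the finite measure [k mu] makes an additive function countably
additive, as the tails of a disjoint union have small [k mu]-measure, and
absolutely continuous with respect to [mu]; so Radon-Nikodym applies. *)
Lemma dominated_set_function_density
    (mu : {sigma_finite_measure set T -> \bar R}) (nu : set T -> R) (k : T -> R) :
  (forall A B, measurable A -> measurable B -> A `&` B = set0 ->
    nu (A `|` B) = nu A + nu B) ->
  mu.-integrable setT (EFin \o k) ->
  (forall A, measurable A -> `|nu A| <= \int[mu]_(x in A) k x) ->
  exists g : T -> R, mu.-integrable setT (EFin \o g) /\
    forall A, measurable A -> nu A = \int[mu]_(x in A) g x.
Proof.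
move=> nuU ik nuk; pose K A := \int[mu]_(x in A) k x.
have KE A : measurable A -> induced_charge ik A = (K A)%:E.
  move=> mA; rewrite /K /Rintegral fineK//; apply: integrable_fin_num => //.
  exact: (integrableS _ _ _ ik).
have KU A B : measurable A -> measurable B -> A `&` B = set0 ->
    K (A `|` B) = K A + K B.
  move=> mA mB AB; rewrite /K Rintegral_setU//; last by apply/disj_setPS; rewrite AB.
  by apply: (integrableS _ _ _ ik) => //; exact: measurableU.
(* Applied both to [nu] and to its dominating measure: the partial sums differ
   from the total by the value on the tail. *)
have sum_tail (m : set T -> R) : (forall A B, measurable A -> measurable B ->
    A `&` B = set0 -> m (A `|` B) = m A + m B) -> forall F n,
    (forall i, measurable (F i)) -> trivIset setT F ->
    \sum_(0 <= i < n) m (F i) = m (\bigcup_n F n) - m (\bigcup_i F (n + i)%N).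
  move=> mU F n mF tF; elim: n => [|n IH].
    by rewrite big_geq// subrr.
  rewrite big_nat_recr//= IH.
  have -> : \bigcup_i F (n + i)%N = F n `|` \bigcup_i F (n.+1 + i)%N.
    apply/seteqP; split => [x [[|i] _]|x [Fnx|[i _]]].
    - by rewrite addn0; left.
    - by rewrite -addSnnS; right; exists i.
    - by exists 0%N => //; rewrite addn0.
    - by rewrite addSnnS; exists i.+1.
  rewrite mU//; first by ring.
    exact: bigcupT_measurable.
  apply/seteqP; split => // x [Fnx [i _ Fix]].
  move/trivIsetP : tF => /(_ n (n.+1 + i)%N Logic.I Logic.I).
  rewrite neq_ltn addSn ltnS leq_addr => /(_ isT) /seteqP[+ _].
  by move=> /(_ x); apply; split => //; rewrite -addSn.
have nusigma : semi_sigma_additive (EFin \o nu : set T -> \bar R).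
  move=> F mF tF mUF.
  have mtail n : measurable (\bigcup_i F (n + i)%N) by exact: bigcupT_measurable.
  have Kcvg : K (\bigcup_i F (n + i)%N) @[n --> \oo] --> 0.
    have : (\sum_(0 <= i < n) induced_charge ik (F i))%E @[n --> \oo]
        --> induced_charge ik (\bigcup_n F n).
      exact: charge_semi_sigma_additive.
    rewrite KE// => /fine_cvgP[_].
    under eq_cvg => n do
      rewrite /= (eq_bigr _ (fun i _ => KE _ (mF i))) sumEFin/= sum_tail//.
    move=> Kc; rewrite -[0](subrr (K (\bigcup_n F n))).
    apply: cvg_trans (cvgB (cvg_cst (K (\bigcup_n F n))) Kc).
    by apply: near_eq_cvg; near=> n; rewrite /= opprB addrC subrK.
  have nucvg : nu (\bigcup_i F (n + i)%N) @[n --> \oo] --> 0.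
    apply/norm_cvg0P; apply: (squeeze_cvgr _ (cvg_cst 0) Kcvg).
    by near=> n; rewrite normr_ge0 nuk.
  apply/fine_cvgP; split; first by near=> n; rewrite sumEFin.
  under eq_cvg => n do rewrite /= sumEFin/= sum_tail//.
  have := cvgB (cvg_cst (nu (\bigcup_n F n))) nucvg.
  by rewrite subr0; exact.
have nu0 : nu set0 = 0.
  have := nuU set0 set0 measurable0 measurable0 (setI0 _).
  by rewrite setU0 => /eqP; rewrite -subr_eq0 opprD addNKr oppr_eq0 => /eqP.
pose nuC := isCharge.Build _ _ _ (EFin \o nu : set T -> \bar R)
  (congr1 EFin nu0) (fun _ _ => isT) nusigma.
pose NU : {charge set T -> \bar R} := HB.pack (EFin \o nu : set T -> \bar R) nuC.
have numu : NU `<< mu.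
  apply/null_content_dominatesP => A mA A0 /=; apply/eqP.
  rewrite eqe -normr_le0 (le_trans (nuk _ mA))//.
  rewrite -lee_fin -KE// /induced_charge.
  by rewrite null_set_integral//; exact/(measurable_int mu)/(integrableS _ _ _ ik).
pose g := fine \o Radon_Nikodym NU mu.
have gE : EFin \o g = Radon_Nikodym NU mu.
  by apply/funext => x /=; rewrite fineK// Radon_Nikodym_fin_num.
exists g; split; first by rewrite gE; exact: Radon_Nikodym_integrable.
move=> A mA; have := Radon_Nikodym_integral numu mA.
by rewrite /Rintegral -gE => <-.
Unshelve. all: by end_near. Qed.

End real_integration.

(** * Complex integrable and bounded functions on the circle *)

Section complex_functions.
Variable R : realType.
Implicit Types (f g : circle R -> R[i]) (A B : set (circle R)).
Local Notation mu := (haar R).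

Lemma Re_mulc (x y : R[i]) : complex.Re (x * y) =
  complex.Re x * complex.Re y - complex.Im x * complex.Im y.
Proof. by case: x; case: y. Qed.

Lemma Im_mulc (x y : R[i]) : complex.Im (x * y) =
  complex.Re x * complex.Im y + complex.Im x * complex.Re y.
Proof. by case: x; case: y. Qed.

Lemma Re_addc (x y : R[i]) : complex.Re (x + y) = complex.Re x + complex.Re y.
Proof. by case: x; case: y. Qed.

Lemma Im_addc (x y : R[i]) : complex.Im (x + y) = complex.Im x + complex.Im y.
Proof. by case: x; case: y. Qed.

Lemma Re_oppc (x : R[i]) : complex.Re (- x) = - complex.Re x.
Proof. by case: x. Qed.

Lemma Im_oppc (x : R[i]) : complex.Im (- x) = - complex.Im x.
Proof. by case: x. Qed.

Lemma normc_conj (x : R[i]) : `|x^*| = `|x|.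
Proof. by case: x => a b; rewrite !normc_def /= sqrrN. Qed.

Lemma normc_ge_Im (x : R[i]) : `|complex.Im x|%:C <= `|x|.
Proof.
by rewrite normc_def lecR -sqrtr_sqr ler_sqrt ?lerDr ?sqr_ge0// addr_ge0 ?sqr_ge0.
Qed.

Definition cindic A : circle R -> R[i] := fun z => (\1_A z : R)%:C.

Lemma cmeasurableD f g : cmeasurable f -> cmeasurable g ->
  cmeasurable (fun z => f z + g z).
Proof.
move=> [fr fi] [gr gi]; split.
  by under eq_fun do rewrite Re_addc; exact: measurable_funD.
by under eq_fun do rewrite Im_addc; exact: measurable_funD.
Qed.

Lemma cmeasurableM f g : cmeasurable f -> cmeasurable g ->
  cmeasurable (fun z => f z * g z).
Proof.
move=> [fr fi] [gr gi]; split.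
  by under eq_fun do rewrite Re_mulc; apply: measurable_funB; exact: measurable_funM.
by under eq_fun do rewrite Im_mulc; apply: measurable_funD; exact: measurable_funM.
Qed.

Lemma cmeasurable_conj f : cmeasurable f -> cmeasurable (fun z => (f z)^*).
Proof.
move=> [fr fi]; split; first by apply: eq_measurable_fun fr => z _; case: (f z).
have : measurable_fun setT (fun z => - complex.Im (f z)).
  by apply: measurableT_comp fi.
by apply: eq_measurable_fun => z _; case: (f z).
Qed.

Lemma Linfty_cst (a : R[i]) : Linfty (fun=> a : R[i]).
Proof.
split; first by split; exact: measurable_cst.
exists (complex.Re `|a|); apply: nearW => z.
by rewrite RRe_real// normr_real.
Qed.

Lemma Linfty_indic A : measurable A -> Linfty (cindic A).
Proof.
move=> mA; split.
  by split; [exact: measurable_indic|exact: measurable_cst].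
exists 1; apply: nearW => z; rewrite /cindic indicE.
by case: (z \in A); rewrite ?normr1 ?normr0 ?ler01.
Qed.

Lemma LinftyD f g : Linfty f -> Linfty g -> Linfty (fun z => f z + g z).
Proof.
move=> [mf [M fM]] [mg [M' gM']]; split; first exact: cmeasurableD.
exists (M + M'); apply: filterS2 fM gM' => z fz gz.
by rewrite (le_trans (ler_normD _ _))// rmorphD lerD.
Qed.

Lemma LinftyM f g : Linfty f -> Linfty g -> Linfty (fun z => f z * g z).
Proof.
move=> [mf [M fM]] [mg [M' gM']]; split; first exact: cmeasurableM.
exists (M * M'); apply: filterS2 fM gM' => z fz gz.
by rewrite normrM rmorphM ler_pM.
Qed.

Lemma Linfty_conj f : Linfty f -> Linfty (fun z => (f z)^*).
Proof.
move=> [mf [M fM]]; split; first exact: cmeasurable_conj.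
by exists M; apply: filterS fM => z; rewrite normc_conj.
Qed.

Lemma Linfty_ReIm_bounded f : Linfty f -> exists M : R,
  (\forall z \ae mu, `|complex.Re (f z)| <= M) /\
  (\forall z \ae mu, `|complex.Im (f z)| <= M).
Proof.
move=> [_ [M fM]]; exists M.
by split; apply: filterS fM => z fz; rewrite -lecR (le_trans _ fz)//
  ?normc_ge_Re ?normc_ge_Im.
Qed.

Lemma L1D f g : L1 f -> L1 g -> L1 (fun z => f z + g z).
Proof.
move=> [fr fi] [gr gi]; split.
  by under eq_fun do rewrite Re_addc EFinD; exact: integrableD.
by under eq_fun do rewrite Im_addc EFinD; exact: integrableD.
Qed.

Lemma L1M f g : Linfty f -> L1 g -> L1 (fun z => f z * g z).
Proof.
move=> Lf [gr gi]; have [M [fr fi]] := Linfty_ReIm_bounded Lf.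
case: (Lf) => -[mr mi] _; split.
  under eq_fun do rewrite Re_mulc EFinB.
  by apply: integrableB; rewrite //;
    [exact: (integrable_ae_boundedM mr fr)|exact: (integrable_ae_boundedM mi fi)].
under eq_fun do rewrite Im_mulc EFinD.
by apply: integrableD; rewrite //;
  [exact: (integrable_ae_boundedM mr fr)|exact: (integrable_ae_boundedM mi fi)].
Qed.

Lemma cintegralD f g : L1 f -> L1 g ->
  cintegral (fun z => f z + g z) = cintegral f + cintegral g.
Proof.
move=> [fr fi] [gr gi]; rewrite /cintegral.
under eq_Rintegral do rewrite Re_addc.
rewrite RintegralD//; under [X in _ +i* X]eq_Rintegral do rewrite Im_addc.
by rewrite RintegralD.
Qed.

Lemma cintegralZ (a : R[i]) f : L1 f ->
  cintegral (fun z => a * f z) = a * cintegral f.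
Proof.
move=> [fr fi]; rewrite /cintegral.
under eq_Rintegral do rewrite Re_mulc.
under [X in _ +i* X]eq_Rintegral do rewrite Im_mulc.
have iZ (c : R) u : mu.-integrable setT (EFin \o u) ->
    mu.-integrable setT (EFin \o (fun z => c * u z)).
  exact: (integrableZl measurableT c).
by rewrite RintegralB ?RintegralD ?RintegralZl//; [case: a|exact: iZ..].
Qed.

Lemma cintegral_indic A f : measurable A -> L1 f ->
  cintegral (fun z => cindic A z * f z) =
  (\int[mu]_(z in A) complex.Re (f z)) +i* (\int[mu]_(z in A) complex.Im (f z)).
Proof.
move=> mA Lf; rewrite /cintegral; congr (_ +i* _); rewrite [RHS]Rintegral_mkcond.
  apply: eq_Rintegral => z _; rewrite Re_mulc/= mul0r subr0 patchE indicE.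
  by case: (z \in A); rewrite ?mul1r ?mul0r.
apply: eq_Rintegral => z _; rewrite Im_mulc/= mul0r addr0 patchE indicE.
by case: (z \in A); rewrite ?mul1r ?mul0r.
Qed.

(** Integrals over all measurable sets determine an integrable function; this is
the test used for uniqueness and for the Ruelle equation. *)
Lemma L1_ae_eq_indic f g : L1 f -> L1 g ->
  (forall A, measurable A -> cintegral (fun z => cindic A z * f z) =
                             cintegral (fun z => cindic A z * g z)) ->
  f = g %[ae mu].
Proof.
move=> Lf Lg fg; case: (Lf) (Lg) => [fr fi] [gr gi].
have mg u : mu.-integrable setT (EFin \o u) -> measurable_fun setT (EFin \o u).
  exact: measurable_int.
have fin u A : measurable A -> mu.-integrable setT (EFin \o u) ->
    (\int[mu]_(z in A) u z)%:E = (\int[mu]_(z in A) (u z)%:E)%E.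
  move=> mA iu; rewrite /Rintegral fineK//; apply: integrable_fin_num => //.
  exact: integrableS iu.
have re : ae_eq mu setT (fun z => (complex.Re (f z))%:E)
                        (fun z => (complex.Re (g z))%:E).
  apply: integral_ae_eq => //; first exact: mg.
  move=> A _ mA; have := fg A mA; rewrite !cintegral_indic// => -[+ _].
  by move=> e; rewrite -!fin// e.
have im : ae_eq mu setT (fun z => (complex.Im (f z))%:E)
                        (fun z => (complex.Im (g z))%:E).
  apply: integral_ae_eq => //; first exact: mg.
  move=> A _ mA; have := fg A mA; rewrite !cintegral_indic// => -[_].
  by move=> e; rewrite -!fin// e.
apply: filterS2 re im => z /(_ Logic.I)[rez] /(_ Logic.I)[imz] _.
by apply/eqP; rewrite eq_complex rez imz !eqxx.
Qed.

End complex_functions.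

(** * Linear functionals vanishing on indicators *)

Section dyadic_extension.
Variable R : realType.
Implicit Types f g : circle R -> R[i].
Local Notation mu := (haar R).

(** A function [f] with values in [[0, 1]] is [(1_A + g) / 2] where
[A = {f >= 1/2}] and [g = 2 f - 1_A] again has values in [[0, 1]]. As [E]
vanishes on indicators, [E f = E g / 2], and iterating divides the bound [K] by
any power of 2. An arbitrary bounded function is an affine combination of
functions with values in [[0, 1]]. *)
Lemma linear_eq0_on_Linfty (E : (circle R -> R[i]) -> R[i]) (K : R) :
  (forall a f g, Linfty f -> Linfty g ->
    E (fun z => a * f z + g z) = a * E f + E g) ->
  (forall A, measurable A -> E (cindic A) = 0) ->
  (forall f, Linfty f -> (\forall z \ae mu, 0 <= f z <= 1) ->
    `|E f| <= K%:C) ->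
  forall f, Linfty f -> E f = 0.
Proof.
move=> EL E1 EK.
have L1_ A : measurable A -> Linfty (cindic A) := @Linfty_indic R A.
have EZ a f : Linfty f -> E (fun z => a * f z) = a * E f.
  move=> Lf; have := EL a f _ Lf (L1_ _ measurable0).
  rewrite E1// addr0 => <-; congr E; apply/funext => z.
  by rewrite /cindic indicE in_set0 addr0.
have LZ (a : R[i]) f : Linfty f -> Linfty (fun z => a * f z).
  by move=> Lf; apply: LinftyM => //; exact: Linfty_cst.
have bound n : forall f, Linfty f -> (\forall z \ae mu, 0 <= f z <= 1) ->
    `|E f| <= (K / 2 ^+ n)%:C.
  elim: n => [|n IH] f Lf f01; first by rewrite expr0 divr1; exact: EK.
  pose A := [set z | 2^-1 <= complex.Re (f z)].
  have mA : measurable A.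
    case: (Lf) => -[mr _] _.
    rewrite [A](_ : _ = setT `&` (fun z => complex.Re (f z)) @^-1` `[2^-1, +oo[).
      exact: mr.
    by rewrite setTI; apply/seteqP; split => z; rewrite /A/= in_itv/= andbT.
  pose g z := -1 * cindic A z + 2 * f z.
  have Lg : Linfty g by apply: LinftyD; apply: LZ => //; exact: L1_.
  have g01 : \forall z \ae mu, 0 <= g z <= 1.
    apply: filterS f01 => z; rewrite /g /cindic indicE.
    have [|] := boolP (z \in A); rewrite ?notin_setE ?inE /A/=; case: (f z) => a b;
      rewrite !lecE/= => ?; lra.
  have Ef : E f = 2^-1 * E g.
    rewrite /g EL ?EZ//; [|exact: L1_|exact: LZ].
    by rewrite E1// mulr0 add0r mulKf// pnatr_eq0.
  rewrite Ef normrM (_ : (K / 2 ^+ n.+1)%:C = `|2^-1| * (K / 2 ^+ n)%:C).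
    by rewrite ler_wpM2l// IH.
  rewrite ger0_norm ?invr_ge0 ?ler0n// exprSr invfM mulrA mulrC !rmorphM/=.
  by congr (_ * _); rewrite fmorphV rmorph_nat.
have E01 f : Linfty f -> (\forall z \ae mu, 0 <= f z <= 1) -> E f = 0.
  move=> Lf f01; apply/eqP/negPn/negP => Ef0.
  have : 0 < complex.Re `|E f|.
    by rewrite -ltcR RRe_real ?normr_real// normr_gt0.
  set e := complex.Re _ => e0.
  have := bound (Num.bound (`|K| / e)) f Lf f01.
  rewrite -[`|E f|]RRe_real ?normr_real// -/e lecR.
  apply/negP; rewrite -ltNge ltr_pdivrMr ?exprn_gt0//.
  have : `|K| / e < (Num.bound (`|K| / e))%:R by rewrite archi_boundP// divr_ge0// ltW.
  rewrite ltr_pdivrMr// mulrC => /(le_lt_trans (ler_norm K))/lt_le_trans; apply.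
  by rewrite ler_pM2l// -natrX ler_nat ltnW// ltn_expl.
have LC (u : circle R -> R) M : measurable_fun setT u ->
    (\forall z \ae mu, `|u z| <= M) -> Linfty (fun z => (u z)%:C : R[i]).
  move=> mu_ uM; split; first by split => //=; exact: measurable_cst.
  by exists M; apply: filterS uM => z; rewrite normc_def/= expr0n addr0 sqrtr_sqr lecR.
have Ereal (u : circle R -> R) M : measurable_fun setT u ->
    (\forall z \ae mu, `|u z| <= M) -> E (fun z => (u z)%:C) = 0.
  move=> mu_ uM; pose c := `|M| + 1.
  have c0 : 0 < c by rewrite /c ltr_wpDl.
  have Lu := LC u M mu_ uM.
  pose v z : R[i] := (2 * c)^-1%:C * (u z)%:C + 2^-1 * cindic setT z.
  have Lv : Linfty v by apply: LinftyD; apply: LZ => //; exact: L1_.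
  have Ev : E v = 0.
    apply: E01 => //; apply: filterS uM => z uzM.
    rewrite /v /cindic indicE in_setT mulr1.
    have -> : (2^-1 : R[i]) = (2^-1 : R)%:C by rewrite fmorphV rmorph_nat.
    rewrite -rmorphM -rmorphD lecR ?(lecR _ 1).
    have : `|u z| <= c by rewrite (le_trans uzM)// /c (le_trans (ler_norm _))// lerDl.
    rewrite -[c in _ <= c]mulr1 -ler_pdivrMl// -[c^-1]gtr0_norm ?invr_gt0//.
    rewrite -normrM ler_norml invfM -mulrA => /andP[h1 h2].
    by apply/andP; split; lra.
  move: Ev; rewrite /v EL//; last by apply: LZ; exact: L1_.
  rewrite EZ ?E1//; last exact: L1_.
  rewrite mulr0 addr0 => /eqP; rewrite mulf_eq0 => /orP[|/eqP//].
  by rewrite fmorph_eq0 invr_eq0 mulf_eq0 pnatr_eq0/= gt_eqF.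
move=> f Lf; have [M [fr fi]] := Linfty_ReIm_bounded Lf.
case: (Lf) => -[mr mi] _.
have -> : f = fun z => 'i * (complex.Im (f z))%:C + (complex.Re (f z))%:C.
  by apply/funext => z; rewrite addrC -complexE.
rewrite EL; [|exact: LC mi fi|exact: LC mr fr].
by rewrite (Ereal _ M mr)// (Ereal _ M mi)// mulr0 addr0.
Qed.

End dyadic_extension.

(** * The angle of a point of the circle *)

Section circle_argument.
Variable R : realType.
Implicit Types (z w : circle R) (s t : R).

Lemma circle_expD s t :
  val (circle_exp (s + t)) = val (circle_exp s) * val (circle_exp t).
Proof.
rewrite /= mulrDr cosD sinD; apply/eqP; rewrite eq_complex /=.
by apply/andP; split; apply/eqP; ring.
Qed.

Lemma circle_exp0 : val (circle_exp (0 : R)) = 1.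
Proof. by rewrite /= mulr0 cos0 sin0. Qed.

Lemma circle_exp1 : val (circle_exp (1 : R)) = 1.
Proof. by rewrite /= mulr1 mulr_natl cos2pi sin2pi. Qed.

Lemma circle_exp_natM (n : nat) t :
  val (circle_exp (n%:R * t)) = val (circle_exp t) ^+ n.
Proof.
elim: n => [|n IH]; first by rewrite mul0r circle_exp0 expr0.
by rewrite -natr1 mulrDl mul1r circle_expD IH exprSr.
Qed.

Lemma circle_exp_addn t (n : nat) : circle_exp (t + n%:R) = circle_exp t.
Proof.
apply/val_inj; rewrite circle_expD -[n%:R]mulr1 circle_exp_natM circle_exp1.
by rewrite expr1n mulr1.
Qed.

Lemma circle_pow_exp (n : nat) t :
  circle_pow n (circle_exp t) = circle_exp (n%:R * t).
Proof. by apply/val_inj; rewrite circle_exp_natM. Qed.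

Lemma circle_exp_inj s t : 0 <= s < 1 -> 0 <= t < 1 ->
  circle_exp s = circle_exp t -> s = t.
Proof.
wlog st : s t / s <= t.
  move=> W s01 t01 e; have [st|/ltW ts] := leP s t; first exact: W.
  by apply/esym/W.
move=> s01 t01 e; apply/eqP; rewrite eq_le st/= -subr_le0 leNgt; apply/negP => d0.
have : cos (2 * pi * (t - s)) = 1 :> R.
  move/(congr1 val) : e => /=[ce se].
  by rewrite mulrBr cosB -ce -se -!expr2 cos2Dsin2.
have -> : 2 * pi * (t - s) = (pi * (t - s)) *+ 2 by rewrite -[RHS]mulr_natl mulrA.
rewrite cos_mulr2n cos2sin2 => c1.
have /eqP : sin (pi * (t - s)) ^+ 2 = 0 :> R by lra.
rewrite sqrf_eq0; apply/negP; rewrite gt_eqF// sin_gt0_pi//.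
rewrite mulr_gt0 ?pi_gt0//= -[ltRHS]mulr1 ltr_pM2l ?pi_gt0//.
lra.
Qed.

Lemma circle_exp_surj z : exists t, 0 <= t < 1 /\ circle_exp t = z.
Proof.
have p0 : 0 < 2 * pi :> R by rewrite mulr_gt0// pi_gt0.
have p0' : 2 * pi != 0 :> R by rewrite gt_eqF.
case: z => -[x y] zP.
have xy : x ^+ 2 + y ^+ 2 = 1.
  by have := add_Re2_Im2 (x +i* y); rewrite (eqP zP) expr1n => -[].
have x1 : -1 <= x <= 1.
  rewrite -ler_norml -(ler_pXn2r (n := 2)) ?nnegrE// expr1n.
  by rewrite real_normK ?num_real// -xy lerDl sqr_ge0.
have ca : cos (acos x) = x by rewrite acosK// in_itv.
have sa : sin (acos x) = `|y|.
  by rewrite sin_acos// -xy addrC addKr sqrtr_sqr.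
have [y0|y0] := leP 0 y.
  exists (acos x / (2 * pi)); split.
    rewrite divr_ge0 ?acos_ge0 ?(ltW p0)//= ltr_pdivrMr// mul1r.
    by rewrite (le_lt_trans (acos_lepi x1))// ltr_pMl ?pi_gt0// ltr1n.
  by apply/val_inj => /=; rewrite mulrCA mulfV// mulr1 ca sa ger0_norm.
exists (1 - acos x / (2 * pi)); split.
  apply/andP; split.
    rewrite subr_ge0 ler_pdivrMr// mul1r (le_trans (acos_lepi x1))//.
    by rewrite ler_pMl ?pi_gt0// ler1n.
  rewrite ltrBlDr ltrDl divr_gt0// lt_neqAle acos_ge0// andbT.
  apply/eqP => a0; move: sa; rewrite -a0 sin0 => /esym/eqP.
  by rewrite normr_eq0 lt_eqF.
apply/val_inj => /=; rewrite mulrBr mulr1 mulrCA mulfV// mulr1.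
rewrite cosB sinB mulr_natl cos2pi sin2pi ca sa ltr0_norm//.
by rewrite !mul0r mulrN !mul1r opprK addr0 add0r.
Qed.

(** The angle of [z] in turns. *)
Definition arg z : R := sval (cid (circle_exp_surj z)).

Lemma arg_itv z : 0 <= arg z < 1.
Proof. by rewrite /arg; case: cid => ? []. Qed.

Lemma circle_exp_arg : cancel arg (@circle_exp R).
Proof. by move=> z; rewrite /arg; case: cid => ? []. Qed.

Lemma arg_circle_exp t : 0 <= t < 1 -> arg (circle_exp t) = t.
Proof.
by move=> t01; apply: circle_exp_inj => //; [exact: arg_itv|exact: circle_exp_arg].
Qed.

Lemma continuous_circle_exp : continuous (fun t => val (circle_exp t) : R[i]^o).
Proof.
have -> : (fun t : R => val (circle_exp t) : R[i]^o) =
    (fun t => (cos (2 * pi * t))%:C + 'i * (sin (2 * pi * t))%:C).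
  by apply/funext => t; rewrite /= [LHS]complexE.
have cl : continuous (fun t : R => 2 * pi * t).
  by move=> t; apply: cvgM; [exact: cvg_cst|exact: cvg_id].
have cC (u : R -> R) : continuous u -> continuous (fun t => (u (2 * pi * t))%:C : R[i]^o).
  move=> cu t; apply: (continuous_comp (g := fun t : R => t%:C : R[i]^o)).
    by apply: continuous_comp; [exact: cl|exact: cu].
  exact: continuous_real_complex.
move=> t; apply: (@cvgD _ R[i]^o); first exact/cC/continuous_cos.
apply: (@cvgM R[i]^o _ _ _ (cst 'i)); first exact: cvg_cst.
exact/cC/continuous_sin.
Qed.

(** For [0 <= a < 1], the set [arg <= a] is the image of the segment [[0, a]]
under the continuous map [circle_exp], hence compact, hence closed. *)
Lemma measurable_arg : measurable_fun setT arg.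
Proof.
apply: (measurability _ (RGenOInfty.measurableE R)) => _ [_ [a ->] <-].
rewrite setTI -[X in measurable X]setCK; apply: measurableC.
have -> : ~` (arg @^-1` `]a, +oo[) = [set z | arg z <= a].
  by apply/seteqP; split => z /=; rewrite in_itv/= andbT leNgt => /negP.
have [a0|a0] := ltP a 0.
  rewrite (_ : [set z | _] = set0)//; apply/seteqP; split => // z /=.
  by case/andP : (arg_itv z) => z0 _ /(le_trans z0); rewrite leNgt a0.
have [a1|a1] := leP 1 a.
  rewrite (_ : [set z | _] = setT)//; apply/seteqP; split => // z _ /=.
  by case/andP : (arg_itv z) => _ /ltW z1; exact: le_trans a1.
pose K := (fun t => val (circle_exp t) : R[i]^o) @` `[0, a].
have clK : closed K.
  apply: compact_closed; first exact: norm_hausdorff.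
  apply: continuous_compact; last exact: segment_compact.
  exact/continuous_subspaceT/continuous_circle_exp.
rewrite (_ : [set z | _] = ~` (val @^-1` (~` K))).
  apply: measurableC; apply: sub_sigma_algebra.
  by exists (~` K) => //; exact: closed_openC.
rewrite preimage_setC setCK; apply/seteqP; split => [z za|z [t /=]].
  exists (arg z); last by rewrite circle_exp_arg.
  by rewrite /= in_itv/= za andbT; case/andP : (arg_itv z).
rewrite in_itv/= => /andP[t0 ta] e.
have <- : circle_exp t = z by exact: val_inj.
by rewrite /= arg_circle_exp// t0 (le_lt_trans ta).
Qed.


End circle_argument.

(** * Inverse branches of the power map and the Ruelle operator *)

(** The push-forward bundled as a measure, with the proof of measurability of
[f] as an explicit argument. *)
Definition image_measure d d' (T1 : measurableType d) (T2 : measurableType d')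
    (R : realType) (m : {measure set T1 -> \bar R}) (f : T1 -> T2)
    (mf : measurable_fun setT f) : {measure set T2 -> \bar R} :=
  measure_function_pushforward__canonical__measure_function_Measure m mf.

Section inverse_branches.
Variables (R : realType) (N : nat).
Hypothesis N0 : (0 < N)%N.
Implicit Types (z w : circle R) (A : set (circle R)) (k : nat).
Local Notation mu := (haar R).
Local Notation lam := (@lebesgue_measure R).

(** The inverse branches of [z |-> z^N]: for [k < N], [branch k z] is
the [N]-th root of [z] whose [arg] lies in [[k / N, (k + 1) / N[[. *)
Definition branch k z : circle R := circle_exp ((arg z + k%:R) / N%:R).

Let N0r : (0 : R) < N%:R. Proof. by rewrite ltr0n. Qed.
Let Nneq0 : (N%:R : R) != 0. Proof. by rewrite pnatr_eq0 -lt0n. Qed.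

Lemma branch_itv k z : (k < N)%N -> 0 <= (arg z + k%:R) / N%:R < 1.
Proof.
move=> kN; case/andP : (arg_itv z) => z0 z1; apply/andP; split.
  by rewrite divr_ge0 ?ler0n// addr_ge0.
rewrite ltr_pdivrMr// mul1r (@lt_le_trans _ _ (1 + k%:R))// ?ltrD2r//.
by rewrite addrC natr1 ler_nat.
Qed.

Lemma branchK k : cancel (branch k) (circle_pow N).
Proof.
move=> z; rewrite /branch circle_pow_exp mulrCA mulfV// mulr1.
by rewrite circle_exp_addn circle_exp_arg.
Qed.

Lemma measurable_affine k : measurable_fun setT (fun t : R => (t + k%:R) / N%:R).
Proof. by apply: measurable_funM => //; exact: measurable_funD. Qed.

Lemma measurable_branch k : measurable_fun setT (branch k).
Proof.
apply: (measurableT_comp (@measurable_circle_exp R)).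
exact: (measurableT_comp (measurable_affine k) (@measurable_arg R)).
Qed.

(** The branches enumerate each fibre of [z |-> z^N] without repetition, which
turns the sum in the Ruelle operator into a sum over [k < N]. *)
Lemma branch_bij z :
  set_bij `I_N [set w | circle_pow N w = z] (fun k => branch k z).
Proof.
split.
- by move=> k _; exact: branchK.
- move=> i j /set_mem/= iN /set_mem/= jN /circle_exp_inj.
  move=> /(_ (branch_itv _ iN) (branch_itv _ jN)) /(mulIf (invr_neq0 Nneq0)).
  by move=> /addrI/eqP; rewrite eqr_nat => /eqP.
- move=> w /= wz; case/andP : (arg_itv w) => w0 w1.
  have Nw0 : 0 <= N%:R * arg w by rewrite mulr_ge0 ?ler0n.
  pose k := Num.truncn (N%:R * arg w).
  have /andP[kle klt] : k%:R <= N%:R * arg w < k.+1%:R by exact: Num.Theory.truncn_itv.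
  have kN : (k < N)%N.
    by rewrite -(ltr_nat R) (le_lt_trans kle)// gtr_pMr.
  exists k => //; rewrite /branch.
  suff -> : arg z = N%:R * arg w - k%:R.
    by rewrite subrK mulrAC mulfV// mul1r circle_exp_arg.
  apply: circle_exp_inj; first exact: arg_itv.
    by rewrite subr_ge0 kle/= ltrBlDl natr1.
  rewrite circle_exp_arg -wz -[in LHS](circle_exp_arg w) circle_pow_exp.
  by rewrite -(circle_exp_addn (_ - _) k) subrK.
Qed.

Lemma ruelle_branch (m m' f : circle R -> R[i]) z : ruelle N m m' f z =
  N%:R^-1 * \sum_(k < N)
    ((m (branch k z))^* * m' (branch k z) * f (branch k z)).
Proof.
rewrite /ruelle (reindex_fsbig (fun k => branch k z) `I_N)//; last exact: branch_bij.
by rewrite -fsbig_ord.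
Qed.

(** Dividing the image of Lebesgue measure by [N] gives a measure that agrees with
Lebesgue measure on half-open intervals, hence everywhere. *)
Lemma lebesgue_affine k (B : set (measurableTypeR R)) : measurable B ->
  (lam ((fun t : R => ((t + k%:R) / N%:R)%R) @^-1` B) = N%:R%:E * lam B)%E.
Proof.
move=> mB.
have Ninv0 : 0 <= (N%:R^-1 : R) by rewrite invr_ge0 ltW.
pose f : R -> measurableTypeR R := fun t : R => (t + k%:R) / N%:R.
have mf : measurable_fun setT f := measurable_affine k.
suff -> : lam B = mscale (NngNum Ninv0) (image_measure lam mf) B.
  by rewrite /mscale/= /pushforward muleA -EFinM mulfV// mul1e.
apply: lebesgue_measure_unique => //= _ [[a b]] _ <-.
rewrite /mscale/= /pushforward.
have -> : f @^-1` `]a, b] = `]a * N%:R - k%:R, b * N%:R - k%:R]%classic.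
  apply/seteqP; split => t /=; rewrite !in_itv/= /f ltr_pdivlMr// ler_pdivrMr//.
    by rewrite ltrBlDr lerBrDr.
  by rewrite ltrBlDr lerBrDr.
rewrite !lebesgue_measure_itv/= !lte_fin ltrD2r ltr_pM2r//.
case: ifPn => _; last by rewrite mule0.
rewrite -!EFinB -EFinM; congr EFin.
by field.
Qed.

(** In the angle coordinate, [branch k] contracts [[0, 1[[ affinely by [1 / N]
onto the [k]-th of the [N] intervals that make up [[0, 1[[. *)
Lemma haar_branch A : measurable A ->
  (N%:R%:E * mu A = \sum_(k < N) mu (branch k @^-1` A))%E.
Proof.
move=> mA; pose B := @circle_exp R @^-1` A.
have mB : measurable B.
  by rewrite /B -[X in measurable X]setTI; exact: measurable_circle_exp.
pose I a : set R := `[0, a / N%:R[%classic `&` B.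
have mI a : measurable (I a) by exact: measurableI.
pose J k := `[k%:R / N%:R, k.+1%:R / N%:R[%classic `&` B.
have mJ k : measurable (J k) by exact: measurableI.
have JE k : (k < N)%N -> mu (branch k @^-1` A) = (N%:R%:E * lam (J k))%E.
  move=> kN; rewrite -(lebesgue_affine k); last exact: mJ.
  rewrite /haar /pushforward /mrestr.
  congr (lam _); apply/seteqP; split => t /=.
    rewrite in_itv/= => -[At] t01; split; last first.
      by move: At; rewrite /branch /= arg_circle_exp.
    rewrite /= in_itv/= ler_pM2r ?invr_gt0// ltr_pM2r ?invr_gt0//.
    by rewrite lerDr -natr1 addrC ltrD2l.
  rewrite /J/= in_itv/= ler_pM2r ?invr_gt0// ltr_pM2r ?invr_gt0//.
  rewrite lerDr -natr1 addrC ltrD2l => -[t01 At].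
  by rewrite in_itv/= t01 /branch arg_circle_exp// addrC.
under eq_bigr do rewrite JE//.
rewrite -ge0_sume_distrr//; congr (_ * _)%E.
have -> : mu A = lam (I N%:R).
  by rewrite /haar /pushforward /mrestr /I divff// setIC.
have : forall n, lam (I n%:R) = (\sum_(k < n) lam (J k))%E.
  elim=> [|n IH].
    rewrite big_ord0 (_ : I _ = set0) ?measure0// /I mul0r set_itv_ge ?set0I//.
    by rewrite bnd_simp ltxx.
  rewrite big_ord_recr/= -IH -measureU; [|exact: mI|exact: mJ|].
    congr (lam _); rewrite /I /J -setIUl; congr (_ `&` _).
    apply/seteqP; split => t /=; rewrite !in_itv/=.
      move=> /andP[t0 tn]; have [ln|nl] := ltP t (n%:R / N%:R).
        by left; rewrite t0.
      by right; rewrite tn.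
    move=> [/andP[t0 tn]|/andP[tn ->]].
      by rewrite t0/= (lt_le_trans tn)// ler_pM2r ?invr_gt0// ler_nat.
    by rewrite andbT (le_trans _ tn)// divr_ge0.
  apply/seteqP; split => // t [[/=]]; rewrite !in_itv/= => /andP[_ tn] _ [].
  by move=> /andP[]; rewrite bnd_simp leNgt tn.
exact.
Qed.

Lemma ge0_integral_branch (F : circle R -> \bar R) :
  measurable_fun setT F -> (forall z, 0 <= F z)%E ->
  (N%:R%:E * \int[mu]_z F z = \sum_(k < N) \int[mu]_z F (branch k z))%E.
Proof.
move=> mF F0; pose m k := image_measure mu (measurable_branch k).
transitivity (\int[mscale (NngNum (ltW N0r)) mu]_z F z)%E.
  by rewrite ge0_integral_mscale.
transitivity (\int[msum m N]_z F z)%E.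
  by apply: eq_measure_integral => A mA _; exact: haar_branch.
rewrite ge0_integral_measure_sum//; apply: eq_bigr => k _.
have mb := measurable_branch k.
have F0' : {in [set: circle R], forall z, (0 <= F z)%E} by move=> z _.
have := ge0_integral_pushforward mb mu measurableT mF F0'.
by rewrite preimage_setT; apply: etrans; apply: eq_measure_integral.
Qed.

Lemma integrable_branch k (g : circle R -> R) : (k < N)%N ->
  mu.-integrable setT (EFin \o g) ->
  mu.-integrable setT (EFin \o (g \o branch k)).
Proof.
move=> kN ig; have mEg := measurable_int _ ig.
have mb := measurable_branch k.
have mag : measurable_fun setT (fun z => `|(g z)%:E|%E) by exact: measurableT_comp.
case/integrableP : (ig) => _ fin; apply/integrableP; split.
  exact: (measurableT_comp mEg mb).
apply: (@le_lt_trans _ _ (N%:R%:E * \int[mu]_z `|(g z)%:E|)%E); last first.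
  by rewrite lte_mul_pinfty// ?lee_fin ?ler0n.
rewrite ge0_integral_branch// (bigD1 (Ordinal kN))//= leeDl// sume_ge0// => i _.
exact: integral_ge0.
Qed.

(** [ge0_integral_branch] extends to [g] through [g = (|g| + g) - |g|]. *)
Lemma Rintegral_branch (g : circle R -> R) : mu.-integrable setT (EFin \o g) ->
  \int[mu]_z g z = N%:R^-1 * \sum_(k < N) \int[mu]_z g (branch k z).
Proof.
have ge0 (f : circle R -> R) : mu.-integrable setT (EFin \o f) ->
    (forall z, 0 <= f z) ->
    \int[mu]_z f z = N%:R^-1 * \sum_(k < N) \int[mu]_z f (branch k z).
  move=> jf f0; apply: (mulfI Nneq0); rewrite mulrA mulfV// mul1r.
  apply: EFin_inj; rewrite EFinM /Rintegral fineK; last exact: integrable_fin_num.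
  have mf := measurable_int _ jf.
  rewrite ge0_integral_branch// -sumEFin; apply: eq_bigr => k _.
  by rewrite fineK//; apply: integrable_fin_num => //; exact: integrable_branch.
move=> ig.
have iag : mu.-integrable setT (EFin \o (fun z => `|g z|)).
  exact: (integrable_abse ig).
have isg : mu.-integrable setT (EFin \o (fun z => `|g z| + g z)).
  exact: (integrableD measurableT iag ig).
have := ge0 _ isg; rewrite RintegralD// (ge0 _ iag)//.
have -> : \sum_(k < N) \int[mu]_z (`|g (branch k z)| + g (branch k z)) =
    \sum_(k < N) \int[mu]_z `|g (branch k z)| +
    \sum_(k < N) \int[mu]_z g (branch k z).
  rewrite -big_split; apply: eq_bigr => k _; rewrite RintegralD//.
    exact: (integrable_branch _ iag).
  exact: (integrable_branch _ ig).
rewrite mulrDr => e; apply: (addrI _ (e _)) => z.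
by rewrite -lerBlDr sub0r -normrN ler_norm.
Qed.

Lemma L1_branch k f : (k < N)%N -> L1 f -> L1 (f \o branch k).
Proof.
move=> kN [fr fi]; split; first exact: (integrable_branch kN fr).
exact: (integrable_branch kN fi).
Qed.

Lemma L1_sum (F : nat -> circle R -> R[i]) n :
  (forall k, (k < n)%N -> L1 (F k)) -> L1 (fun z => \sum_(k < n) F k z) /\
  cintegral (fun z => \sum_(k < n) F k z) = \sum_(k < n) cintegral (F k).
Proof.
elim: n => [|n IH] LF.
  have -> : (fun z => \sum_(k < 0) F k z) = cst 0 by apply/funext => z; rewrite big_ord0.
  rewrite big_ord0; split; first by split; exact: integrable0.
  by rewrite /cintegral !Rintegral_cst// !mul0r.
have [|L e] := IH; first by move=> k kn; exact/LF/ltnW.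
have -> : (fun z => \sum_(k < n.+1) F k z) = (fun z => \sum_(k < n) F k z + F n z).
  by apply/funext => z; rewrite big_ord_recr.
have Ln := LF n (ltnSn n).
by rewrite big_ord_recr/= -e cintegralD//; split => //; exact: L1D.
Qed.

Lemma cintegral_branch f : L1 f ->
  cintegral f = N%:R^-1 * \sum_(k < N) cintegral (f \o branch k).
Proof.
move=> [fr fi]; rewrite /cintegral (Rintegral_branch fr) (Rintegral_branch fi).
have -> : N%:R^-1 = (N%:R^-1)%:C :> R[i] by rewrite fmorphV rmorph_nat.
apply/eqP; rewrite eq_complex Re_mulc Im_mulc/= !mul0r subr0 addr0.
rewrite (@big_morph _ _ (@complex.Re R) 0 +%R 0 +%R (@Re_addc R) erefl).
by rewrite (@big_morph _ _ (@complex.Im R) 0 +%R 0 +%R (@Im_addc R) erefl) !eqxx.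
Qed.

Lemma measurable_circle_pow : measurable_fun setT (@circle_pow R N).
Proof.
apply: (measurability (@circle_open R)) => // _ [_ [V /= oV <-] <-].
rewrite setTI; apply: sub_sigma_algebra.
exists ((fun x : R[i]^o => x ^+ N : R[i]^o) @^-1` V) => //.
have cX n : continuous (fun x : R[i]^o => x ^+ n : R[i]^o).
  elim: n => [|n IH] x.
    have -> : (fun x : R[i]^o => x ^+ 0 : R[i]^o) = cst 1 by apply/funext.
    exact: cst_continuous.
  have -> : (fun x : R[i]^o => x ^+ n.+1 : R[i]^o) = (fun x => x * x ^+ n).
    by apply/funext => y; rewrite exprS.
  have IHx := IH x.
  exact: (@cvgM R[i]^o _ _ (nbhs_filter x) id _ _ _ cvg_id IHx).
exact: open_comp (fun x _ => cX N x) oV.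
Qed.

(** The Ruelle operator is the transpose of
[f |-> conj m * m' * f(z^N)]: averaging over the branches leaves the integral
unchanged, and the indicator of the preimage of [A], composed with a branch, is
the indicator of [A]. Integrability of the image comes with the same
computation. *)
Lemma cintegral_ruelle (m m' f : circle R -> R[i]) A :
  Linfty m -> Linfty m' -> L1 f -> measurable A ->
  L1 (ruelle N m m' f) /\
  cintegral (fun z => cindic A z * ruelle N m m' f z) =
  cintegral (fun z => cindic (circle_pow N @^-1` A) z *
                      ((m z)^* * m' z * f z)).
Proof.
move=> Lm Lm' Lf mA; pose g z := (m z)^* * m' z * f z.
have Lg : L1 g by apply: L1M => //; apply: LinftyM => //; exact: Linfty_conj.
have Lgb k : (k < N)%N -> L1 (g \o branch k) by move=> kN; exact: L1_branch.
have LA := Linfty_indic mA.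
have [Ls _] := L1_sum Lgb.
have rE : ruelle N m m' f = fun z => N%:R^-1 * \sum_(k < N) (g \o branch k) z.
  by apply/funext => z; rewrite ruelle_branch.
split; first by rewrite rE; apply: L1M => //; exact: Linfty_cst.
have mpA : measurable (circle_pow N @^-1` A).
  by rewrite -[X in measurable X]setTI; exact: measurable_circle_pow.
rewrite [RHS]cintegral_branch; last by apply: L1M => //; exact: Linfty_indic.
have -> : (fun z => cindic A z * ruelle N m m' f z) =
    fun z => N%:R^-1 * \sum_(k < N) (cindic A z * (g \o branch k) z).
  by apply/funext => z; rewrite rE mulrCA mulr_sumr.
have LAg k : (k < N)%N -> L1 (fun z => cindic A z * (g \o branch k) z).
  by move=> kN; apply: L1M => //; exact: Lgb.
have [Ls' sE] := L1_sum LAg.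
rewrite cintegralZ// sE; congr (_ * _); apply: eq_bigr => k _.
congr cintegral; apply/funext => z /=; congr (_ * _).
rewrite /cindic !indicE; congr ((nat_of_bool _)%:R%:C).
apply/idP/idP => /set_mem/= zA; apply/mem_set; first by rewrite /= branchK.
by move: zA; rewrite branchK.
Qed.

End inverse_branches.

(** * Hilbert space estimates *)

Section hilbert.
Variable R : realType.

Section one_space.
Variable H : hilbertType R.
Implicit Types x y : H.

Lemma ipDr x y z : ip x (y + z) = ip x y + ip x z.
Proof. by rewrite -[y]scale1r ip_linearr mul1r scale1r. Qed.

Lemma ip0r x : ip x 0 = 0.
Proof. by apply: (addrI (ip x 0)); rewrite -ipDr !addr0. Qed.

Lemma ipZr (a : R[i]) x y : ip x (a *: y) = a * ip x y.
Proof. by rewrite -[a *: y]addr0 ip_linearr ip0r addr0. Qed.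

Lemma ip_conjE x y : complex.Re (ip y x) = complex.Re (ip x y).
Proof. by rewrite ip_conj; case: (ip x y). Qed.

Lemma Re_normE x : `|x| = (complex.Re `|x|)%:C.
Proof. by rewrite RRe_real// normr_real. Qed.

Lemma Re_norm_ge0 x : 0 <= complex.Re `|x|.
Proof. by rewrite -lecR -Re_normE; exact: normr_ge0. Qed.

Lemma Re_ip_norm x : complex.Re (ip x x) = complex.Re `|x| ^+ 2.
Proof. by rewrite -ip_norm Re_normE -rmorphXn. Qed.

Lemma Re_ip_ge0 x : 0 <= complex.Re (ip x x).
Proof. by rewrite Re_ip_norm sqr_ge0. Qed.

Lemma Re_ipZ (a : R[i]) x : `|a| = 1 ->
  complex.Re (ip (a *: x) (a *: x)) = complex.Re (ip x x).
Proof. by move=> a1; rewrite !Re_ip_norm normrZ a1 mul1r. Qed.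

(** Expand [0 <= |x - y|^2]. *)
Lemma Re_ip_le x y : complex.Re (ip x y) *+ 2 <=
  complex.Re (ip x x) + complex.Re (ip y y).
Proof.
have E z : ip (x + (-1) *: y) z = ip x z - ip y z.
  rewrite ip_conj ipDr ipZr (ip_conj z x) (ip_conj z y).
  by case: (ip z x) => a b; case: (ip z y) => c d /=; apply/eqP;
    rewrite eq_complex/=; apply/andP; split; apply/eqP; ring.
have := Re_ip_ge0 (x + (-1) *: y).
rewrite E !ipDr !ipZr.
have := ip_conjE x y; case: (ip x y) => a b; case: (ip y x) => a' b'.
case: (ip x x) => c d; case: (ip y y) => c' d' /= ->; lra.
Qed.

(** Replace [y] by its multiples by [1], [-1], [i] and [-i]. Applied to
[s x] and [y] for all [s], this arithmetic mean of the squared norms becomes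
their geometric mean. *)
Lemma normr_ReIm_ip_le x y :
  `|complex.Re (ip x y)| *+ 2 <= complex.Re (ip x x) + complex.Re (ip y y) /\
  `|complex.Im (ip x y)| *+ 2 <= complex.Re (ip x x) + complex.Re (ip y y).
Proof.
have P (a : R[i]) : `|a| = 1 -> complex.Re (a * ip x y) *+ 2 <=
    complex.Re (ip x x) + complex.Re (ip y y).
  by move=> a1; rewrite -(Re_ipZ y a1) -ipZr Re_ip_le.
have n1 : `|1 : R[i]| = 1 by rewrite normr1.
have n1' : `|-1 : R[i]| = 1 by rewrite normrN1.
have ni : `|'i%C : R[i]| = 1 by rewrite normc_def/= expr0n add0r expr1n sqrtr1.
have ni' : `|- 'i%C : R[i]| = 1 by rewrite normrN.
move: (P _ n1) (P _ n1') (P _ ni) (P _ ni').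
case: (ip x y) => a b /=; move: (complex.Re _ + _) => c h1 h2 h3 h4.
split.
  case: (ger0P a) => _; lra.
case: (ger0P b) => _; lra.
Qed.

End one_space.

Lemma opnorm_le (H1 H2 : hilbertType R) (A : {linear H1 -> H2}) x :
  bounded_op A ->
  complex.Re (ip (A x) (A x)) <= opnorm A ^+ 2 * complex.Re (ip x x).
Proof.
move=> [M AM]; rewrite !Re_ip_norm -exprMn.
have le : complex.Re `|A x| <= opnorm A * complex.Re `|x|.
  have [->|x0] := eqVneq x 0; first by rewrite linear0 !normr0 mulr0.
  have n0 : 0 < complex.Re `|x| by rewrite -ltcR -Re_normE normr_gt0.
  rewrite -ler_pdivrMr//; apply: ub_le_sup.
    exists `|M| => _ [y /= y1 <-]; rewrite -lecR -Re_normE (le_trans (AM y))//.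
    rewrite (Re_normE y) -rmorphM lecR; move: y1; rewrite Re_normE lecR => y1.
    apply: (@le_trans _ _ (`|M| * complex.Re `|y|)).
      by rewrite ler_wpM2r ?Re_norm_ge0 ?ler_norm.
    by rewrite ler_piMr.
  have nx : `| (`|x|^-1 : R[i]) | = (complex.Re `|x|)^-1%:C.
    by rewrite normfV normr_id {1}Re_normE fmorphV.
  exists (`|x|^-1 *: x) => /=.
    by rewrite normrZ normfV normr_id mulVf// normr_eq0.
  rewrite linearZ normrZ nx (Re_normE (A x)) -rmorphM/= mulrC.
  by [].
rewrite ler_sqr ?nnegrE ?Re_norm_ge0//.
exact: le_trans (Re_norm_ge0 _) le.
Qed.

End hilbert.

(** * Pointwise bounds and signs *)

Section pointwise.
Variable R : realType.
Implicit Types f g : circle R -> R[i].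

(** The inequality between continuous functions of [q] extends to all real
numbers; for [a > 0], the quadratic polynomial is smallest at [q = r / a]. *)
Lemma rational_discriminant (a r c : R) : 0 <= a ->
  (forall q : rat, 2 * ratr q * r <= ratr q ^+ 2 * a + c) -> r ^+ 2 <= a * c.
Proof.
move=> a0 Q.
have P (s : R) : 2 * s * r <= s ^+ 2 * a + c.
  rewrite leNgt; apply/negP => sP.
  pose p (t : R) := 2 * t * r - t ^+ 2 * a.
  have cp : continuous p.
    move=> t; apply: cvgB; apply: cvgM; try exact: cvg_cst.
      by apply: cvgM; [exact: cvg_cst|exact: cvg_id].
    exact: exprn_continuous.
  have oP : open (p @^-1` `]c, +oo[) by apply: open_comp => // t _; exact: cp.
  have [|x [/= pq [q _ qx]]] := dense_rat _ oP.
    by exists s; rewrite /= in_itv/= andbT /p ltrBrDl.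
  move: pq; rewrite -qx in_itv/= andbT /p ltrBrDl ltNge; apply/negP.
  by rewrite negbK Q.
have [a00|] := eqVneq a 0; last first.
  rewrite neq_lt ltNge a0/= => ap; have := P (r / a).
  have -> : 2 * (r / a) * r = 2 * (r ^+ 2 / a) by field; rewrite gt_eqF.
  have -> : (r / a) ^+ 2 * a = r ^+ 2 / a by field; rewrite gt_eqF.
  move=> h; have : r ^+ 2 / a <= c by lra.
  by rewrite ler_pdivrMr// mulrC.
have [->|r0] := eqVneq r 0; first by rewrite expr0n a00 mul0r.
(* For [a = 0] the inequality is linear in [s], and this [s] makes its left side
   [c + 1]. *)
have := P ((c + 1) / (2 * r)); rewrite a00 mulr0 add0r.
have -> : 2 * ((c + 1) / (2 * r)) * r = c + 1 by field.
lra.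
Qed.

Lemma le_ae_Rintegral d (T : measurableType d) (mu : {measure set T -> \bar R})
    (u v : T -> R) :
  mu.-integrable setT (EFin \o u) -> mu.-integrable setT (EFin \o v) ->
  (\forall x \ae mu, u x <= v x) -> \int[mu]_x u x <= \int[mu]_x v x.
Proof.
move=> iu iv uv; rewrite -subr_ge0 -RintegralB//.
have ib : mu.-integrable setT (EFin \o (fun x => v x - u x)).
  exact: (integrableB measurableT iv iu).
have -> : \int[mu]_x (v x - u x) = \int[mu]_x `|v x - u x|.
  congr fine; apply: ae_eq_integral => //.
  - exact: measurable_int ib.
  - by have := measurable_int _ (integrable_abse ib).
  - by apply: filterS uv => x uvx _; rewrite ger0_norm// subr_ge0.
by apply: Rintegral_ge0.
Qed.

(** The bound is uniform in [f], as required by [linear_eq0_on_Linfty]. *)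
Lemma cintegral_bound (f g : circle R -> R[i]) : Linfty f ->
  (\forall z \ae haar R, `|f z| <= 1) -> L1 g ->
  let B := \int[haar R]_z (`|complex.Re (g z)| + `|complex.Im (g z)|) in
  `|complex.Re (cintegral (fun z => f z * g z))| <= B /\
  `|complex.Im (cintegral (fun z => f z * g z))| <= B.
Proof.
move=> Lf f1 Lg; have [ifr ifi] := L1M Lf Lg; case: (Lg) => [gr gi].
have iB : (haar R).-integrable setT
    (EFin \o (fun z => `|complex.Re (g z)| + `|complex.Im (g z)|)).
  exact: (integrableD measurableT (integrable_abse gr) (integrable_abse gi)).
have f1' : \forall z \ae haar R,
    `|complex.Re (f z)| <= 1 /\ `|complex.Im (f z)| <= 1.
  by apply: filterS f1 => z fz; rewrite -!lecR; split; apply: le_trans fz;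
    rewrite ?normc_ge_Re ?normc_ge_Im.
split; apply: (le_trans (le_normr_Rintegral measurableT _)) => //;
  apply: le_ae_Rintegral => //; try exact: (integrable_abse ifr);
  try exact: (integrable_abse ifi); apply: filterS f1' => z [r1 i1].
  rewrite Re_mulc (le_trans (ler_normB _ _))// !normrM lerD// ler_piMl//.
rewrite Im_mulc (le_trans (ler_normD _ _))// !normrM addrC lerD// ler_piMl//.
Qed.

Lemma conjc_mul_norm (x : R[i]) : x^* * x = `|x| ^+ 2.
Proof.
rewrite -add_Re2_Im2; case: x => a b /=.
by apply/eqP; rewrite eq_complex/=; apply/andP; split; apply/eqP; ring.
Qed.

(** It rotates [f] to [|f|] and has modulus 1, except where [f] vanishes: there
its value is 0, as [0^-1 = 0]. *)
Definition conj_sign (f : circle R -> R[i]) : circle R -> R[i] :=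
  fun z => (f z)^* / `|f z|.

Lemma conj_signM f z : conj_sign f z * f z = `|f z|.
Proof.
have [fz0|fz0] := eqVneq (f z) 0; first by rewrite /conj_sign fz0 normr0 mulr0.
by rewrite /conj_sign mulrAC conjc_mul_norm expr2 mulfK ?normr_eq0.
Qed.

Lemma conj_sign_norm f z : f z != 0 -> `|conj_sign f z| = 1.
Proof.
by move=> fz0; rewrite /conj_sign normrM normc_conj normfV normr_id mulfV ?normr_eq0.
Qed.

Lemma measurable_normc f : cmeasurable f ->
  measurable_fun setT (fun z => complex.Re `|f z|).
Proof.
move=> [fr fi].
have mq : measurable_fun setT
    (fun z => complex.Re (f z) ^+ 2 + complex.Im (f z) ^+ 2).
  by apply: measurable_funD; exact: measurable_funX.
apply: eq_measurable_fun (measurableT_comp (measurable_powR (2^-1 : R)) mq).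
by move=> z _; rewrite normc_def/= -powR12_sqrt ?addr_ge0 ?sqr_ge0.
Qed.

Lemma Linfty_conj_sign f : cmeasurable f -> Linfty (conj_sign f).
Proof.
move=> mf; split; last first.
  exists 1; apply: nearW => z; have [fz0|/conj_sign_norm ->//] := eqVneq (f z) 0.
  by rewrite /conj_sign fz0 normr0 invr0 mulr0 normr0 ler01.
apply: cmeasurableM; first exact: cmeasurable_conj.
have nV z : `|f z|^-1 = (complex.Re `|f z| `^ (-1))%:C.
  have nE : `|f z| = (complex.Re `|f z|)%:C by rewrite RRe_real// normr_real.
  have n0 : 0 <= complex.Re `|f z| by rewrite -lecR -nE; exact: normr_ge0.
  by rewrite powR_inv1// [LHS](congr1 GRing.inv nE) -fmorphV.
under eq_fun do rewrite nV.
split => /=; last exact: measurable_cst.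
exact: (measurableT_comp (measurable_powR (-1 : R)) (measurable_normc mf)).
Qed.

End pointwise.

(** * The correlation functional of an intertwiner *)

Section cyclic_representation.
Variables (R : realType) (N : nat).
Implicit Types f g : circle R -> R[i].
Local Notation mu := (haar R).

Lemma cyclic_rep_norm (m0 h : circle R -> R[i]) (H : hilbertType R)
    (pi : (circle R -> R[i]) -> {linear H -> H}) (U : unitary H) (phi : H) f :
  is_cyclic_rep N m0 h pi U phi -> Linfty f ->
  ip (pi f phi) (pi f phi) = cintegral (fun z => (f z)^* * f z * h z).
Proof.
move=> rep Lf; have star := cyclic_star_rep rep.
rewrite -(rep_star star)// -(rep_mul star)//; last exact: Linfty_conj.
by rewrite (cyclic_state rep)//; apply: LinftyM => //; exact: Linfty_conj.
Qed.

Lemma cindic_idem A (z : circle R) : (cindic A z)^* * cindic A z = cindic A z.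
Proof.
rewrite /cindic indicE; case: (z \in A); last by rewrite mulr0.
by rewrite mulr1; apply/eqP; rewrite eq_complex/= oppr0 !eqxx.
Qed.

Lemma cindic_setU A B (z : circle R) : A `&` B = set0 ->
  cindic (A `|` B) z = cindic A z + cindic B z.
Proof.
move=> AB; rewrite /cindic !indicE in_setU -rmorphD -natrD.
case: (boolP (z \in A)) (boolP (z \in B)) => [zA|_] [zB|_];
  rewrite ?addn0 ?add0n//.
have : (A `&` B) z by split; [exact: set_mem zA|exact: set_mem zB].
by rewrite AB.
Qed.

Section intertwiner.
Variables (m0 m0' h h' : circle R -> R[i]) (H H' : hilbertType R).
Variables (pi : (circle R -> R[i]) -> {linear H -> H}) (U : unitary H) (phi : H).
Variables (pi' : (circle R -> R[i]) -> {linear H' -> H'}) (U' : unitary H').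
Variables (phi' : H') (S : {linear H' -> H}).
Hypotheses (N0 : (0 < N)%N) (Lm0 : Linfty m0) (Lm0' : Linfty m0').
Hypotheses (Lh : L1 h) (Lh' : L1 h').
Hypotheses (rep : is_cyclic_rep N m0 h pi U phi).
Hypotheses (rep' : is_cyclic_rep N m0' h' pi' U' phi').
Hypotheses (S_bounded : bounded_op S).
Hypotheses (S_pi : forall f, Linfty f -> forall x, S (pi' f x) = pi f (S x)).
Hypotheses (S_U : forall x, S (U' x) = U (S x)).

Definition correlation f : R[i] := ip phi (S (pi' f phi')).

Lemma correlation_linear (a : R[i]) f g : Linfty f -> Linfty g ->
  correlation (fun z => a * f z + g z) = a * correlation f + correlation g.
Proof.
move=> Lf Lg; rewrite /correlation (rep_linear (cyclic_star_rep rep'))//.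
by rewrite linearP ipDr ipZr.
Qed.

Lemma correlation_conjM f g : Linfty f -> Linfty g ->
  correlation (fun z => (g z)^* * f z) = ip (pi g phi) (S (pi' f phi')).
Proof.
move=> Lf Lg; have Lg' := Linfty_conj Lg.
rewrite /correlation (rep_mul (cyclic_star_rep rep'))// S_pi//.
by rewrite (rep_star (cyclic_star_rep rep)).
Qed.

(** The basic inequality: it controls the set function [A |-> correlation 1_A]
when [f] and [g] are indicators, and the size of the density when they are
adapted to it. *)
Lemma correlation_bound f g : Linfty f -> Linfty g ->
  let C := complex.Re (cintegral (fun z => (g z)^* * g z * h z)) +
    opnorm S ^+ 2 * complex.Re (cintegral (fun z => (f z)^* * f z * h' z)) in
  `|complex.Re (correlation (fun z => (g z)^* * f z))| *+ 2 <= C /\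
  `|complex.Im (correlation (fun z => (g z)^* * f z))| *+ 2 <= C.
Proof.
move=> Lf Lg C; rewrite correlation_conjM//.
have : complex.Re (ip (pi g phi) (pi g phi)) +
    complex.Re (ip (S (pi' f phi')) (S (pi' f phi'))) <= C.
  rewrite /C -(cyclic_rep_norm rep)// -(cyclic_rep_norm rep')// lerD2l.
  exact: opnorm_le.
have [h1 h2] := normr_ReIm_ip_le (pi g phi) (S (pi' f phi')).
by move=> hC; split; [exact: le_trans h1 hC|exact: le_trans h2 hC].
Qed.

(** The set functions given by the real and the imaginary part are both dominated
by the density [h + |S|^2 h']. *)
Lemma correlation_density_on_sets : exists h0, L1 h0 /\
  forall A, measurable A ->
    correlation (cindic A) = cintegral (fun z => cindic A z * h0 z).
Proof.
pose k z := complex.Re (h z) + opnorm S ^+ 2 * complex.Re (h' z).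
case: (Lh) (Lh') => [hr _] [hr' _].
have ihr' : mu.-integrable setT
    (EFin \o (fun z => opnorm S ^+ 2 * complex.Re (h' z))).
  exact: (integrableZl measurableT _ hr').
have ik : mu.-integrable setT (EFin \o k) := integrableD measurableT hr ihr'.
have add A B : measurable A -> measurable B -> A `&` B = set0 ->
    correlation (cindic (A `|` B)) = correlation (cindic A) + correlation (cindic B).
  move=> mA mB AB; rewrite -[correlation (cindic A)]mul1r.
  rewrite -correlation_linear; [|exact: Linfty_indic..].
  by congr correlation; apply/funext => z; rewrite cindic_setU// mul1r.
have bnd A : measurable A ->
    `|complex.Re (correlation (cindic A))| <= \int[mu]_(z in A) k z /\
    `|complex.Im (correlation (cindic A))| <= \int[mu]_(z in A) k z.
  move=> mA; have LA := Linfty_indic mA.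
  have [] := correlation_bound LA LA.
  under eq_fun do rewrite cindic_idem.
  under [X in cintegral X]eq_fun do rewrite cindic_idem.
  under [X in _ + _ * complex.Re (cintegral X)]eq_fun do rewrite cindic_idem.
  rewrite !cintegral_indic//=.
  have AT : A `<=` setT by [].
  rewrite -RintegralZl//; last exact: (integrableS _ mA AT hr').
  rewrite -RintegralD//; last 2 first.
    exact: (integrableS _ mA AT hr).
  exact: (integrableS _ mA AT ihr').
  rewrite -/(k _); set I := Rintegral _ _ _ => h1 h2.
  by split; [move: h1|move: h2]; rewrite mulr2n; apply: le_trans;
    rewrite lerDl.
have [g1 [ig1 g1E]] := @dominated_set_function_density _ _ _ mu
  (fun A => complex.Re (correlation (cindic A))) k
  (fun A B mA mB AB => etrans (congr1 (@complex.Re R) (add A B mA mB AB)) (Re_addc _ _))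
  ik (fun A mA => (bnd A mA).1).
have [g2 [ig2 g2E]] := @dominated_set_function_density _ _ _ mu
  (fun A => complex.Im (correlation (cindic A))) k
  (fun A B mA mB AB => etrans (congr1 (@complex.Im R) (add A B mA mB AB)) (Im_addc _ _))
  ik (fun A mA => (bnd A mA).2).
have Lg : L1 (fun z => g1 z +i* g2 z) by split.
exists (fun z => g1 z +i* g2 z); split=> // A mA.
by rewrite cintegral_indic//= -g1E// -g2E//; case: (correlation _).
Qed.

Lemma correlation_density : exists h0, L1 h0 /\
  forall f, Linfty f -> correlation f = cintegral (fun z => f z * h0 z).
Proof.
have [h0 [Lh0 h0E]] := correlation_density_on_sets.
exists h0; split => // f Lf; apply/eqP; rewrite -subr_eq0; apply/eqP.
pose E f := correlation f - cintegral (fun z => f z * h0 z).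
pose B (g : circle R -> R[i]) :=
  \int[mu]_z (`|complex.Re (g z)| + `|complex.Im (g z)|).
pose C := complex.Re (cintegral h) + opnorm S ^+ 2 * B h'.
apply: (@linear_eq0_on_Linfty _ E (C + B h0 + (C + B h0))) Lf => //.
- move=> a g1 g2 Lg1 Lg2; rewrite /E correlation_linear//.
  under eq_fun do rewrite mulrDl -mulrA.
  have Lg1h : L1 (fun z => g1 z * h0 z) by exact: L1M.
  have Lag1h := L1M (Linfty_cst a) Lg1h.
  rewrite cintegralD// ?cintegralZ//; last exact: L1M.
  by rewrite mulrBr opprD addrACA.
- by move=> A mA; rewrite /E h0E// subrr.
- move=> {}f Lf f01.
  have f1 : \forall z \ae mu, `|f z| <= 1.
    by apply: filterS f01 => z /andP[? ?]; rewrite ger0_norm.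
  have ff1 : \forall z \ae mu, `|(f z)^* * f z| <= 1.
    by apply: filterS f1 => z fz; rewrite normrM normc_conj mulr_ile1//.
  have Lff : Linfty (fun z => (f z)^* * f z).
    by apply: LinftyM => //; exact: Linfty_conj.
  have [b1 b2] := cintegral_bound Lf f1 Lh0.
  have [b3 _] := cintegral_bound Lff ff1 Lh'.
  have [] := correlation_bound Lf (Linfty_cst 1).
  have -> : (fun z => (1 : R[i])^* * f z) = f.
    by apply/funext => z; rewrite rmorph1 mul1r.
  have -> : (fun z => (1 : R[i])^* * 1 * h z) = h.
    by apply/funext => z; rewrite rmorph1 !mul1r.
  set D := (X in _ <= X) => c1 c2.
  have DC : D <= C.
    rewrite lerD2l ler_wpM2l ?sqr_ge0//.
    exact: le_trans (ler_norm _) b3.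
  have nle (x : R[i]) (r : R) : `|complex.Re x| <= r -> `|complex.Im x| <= r ->
      `|x| <= (r + r)%:C.
    case: x => a b /= ar br; rewrite [a +i* b]complexE (le_trans (ler_normD _ _))//=.
    rewrite rmorphD lerD//; last rewrite normrM;
      by rewrite !normc_def/= ?expr0n ?expr1n ?add0r ?addr0 ?sqrtr1 ?mul1r sqrtr_sqr lecR.
  apply: nle.
    rewrite Re_addc Re_oppc (le_trans (ler_normB _ _))// lerD//.
    by rewrite (le_trans _ (le_trans c1 DC))// mulr2n lerDl.
  rewrite Im_addc Im_oppc (le_trans (ler_normB _ _))// lerD//.
  by rewrite (le_trans _ (le_trans c2 DC))// mulr2n lerDl.
Qed.

(** Apply [U] to both vectors: [U] becomes [pi(m0)] on [phi], moves through [S],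
and turns [pi'(f) phi'] into [pi'(f(z^N)) pi'(m0') phi'] by covariance. *)
Lemma correlation_pow f : Linfty f -> Linfty (f \o circle_pow N) ->
  correlation f = correlation (fun z => (m0 z)^* * m0' z * f (circle_pow N z)).
Proof.
move=> Lf Lfp; have star' := cyclic_star_rep rep'.
have -> : (fun z => (m0 z)^* * m0' z * f (circle_pow N z)) =
    (fun z => (m0 z)^* * (f (circle_pow N z) * m0' z)).
  by apply/funext => z; rewrite -mulrA [m0' z * _]mulrC.
rewrite correlation_conjM//; last exact: LinftyM.
rewrite (rep_mul star' Lfp Lm0') -(cyclic_refine rep) -(cyclic_refine rep').
rewrite -(cyclic_covariant rep')// unitary_funK S_U unitary_ip.
by [].
Qed.

(** Both sides have the same integral over each set [A], by [correlation_pow] for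
the indicator of [A] and the transpose formula [cintegral_ruelle]. *)
Lemma density_ruelle_fix h0 : L1 h0 ->
  (forall f, Linfty f -> correlation f = cintegral (fun z => f z * h0 z)) ->
  ruelle N m0 m0' h0 = h0 %[ae mu].
Proof.
move=> Lh0 h0E; have [LR _] := cintegral_ruelle N0 Lm0 Lm0' Lh0 measurable0.
apply: L1_ae_eq_indic => // A mA.
have [_ ->] := cintegral_ruelle N0 Lm0 Lm0' Lh0 mA.
have mpA : measurable (circle_pow N @^-1` A).
  by rewrite -[X in measurable X]setTI; exact: measurable_circle_pow.
have LA := Linfty_indic mA; have LpA := Linfty_indic mpA.
have pE : cindic A \o circle_pow N = cindic (circle_pow N @^-1` A).
  by apply/funext => z; rewrite /cindic/= !indicE.
have pEz z : cindic A (circle_pow N z) = cindic (circle_pow N @^-1` A) z.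
  by rewrite -pE.
rewrite -[RHS](h0E _ LA) (correlation_pow LA); last by rewrite pE.
under [in RHS]eq_fun do rewrite pEz.
rewrite h0E; last first.
  apply: LinftyM; last exact: LpA.
  by apply: LinftyM => //; exact: Linfty_conj.
by congr cintegral; apply/funext => z; rewrite mulrA [cindic _ _ * _]mulrC.
Qed.

(** If the inequality failed on a set [A] of positive measure, integrating over
[A] would contradict [correlation_bound] for [g = s 1_A] and
[f = 1_A * conj_sign h0], since then [conj g * f * h0 = s 1_A |h0|]. *)
Lemma density_scaled_bound h0 (s : R) : L1 h0 ->
  (forall f, Linfty f -> correlation f = cintegral (fun z => f z * h0 z)) ->
  ae_le (cst 0) h -> ae_le (cst 0) h' ->
  \forall z \ae mu, 2 * s * complex.Re `|h0 z| <=
    s ^+ 2 * complex.Re (h z) + opnorm S ^+ 2 * complex.Re (h' z).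
Proof.
move=> Lh0 h0E h_ge0 h'_ge0; case: (Lh) (Lh') => [hr _] [hr' _].
have mh0 : cmeasurable h0.
  by case: (Lh0) => /measurable_int/measurable_EFinP ? /measurable_int/measurable_EFinP ?.
pose n z := complex.Re `|h0 z|.
have in0 : mu.-integrable setT (EFin \o n).
  have [+ _] := L1M (Linfty_conj_sign mh0) Lh0.
  by under eq_fun do rewrite conj_signM.
have mn : measurable_fun setT n by exact: measurable_normc.
pose u z := s ^+ 2 * complex.Re (h z) + opnorm S ^+ 2 * complex.Re (h' z).
have iZ (c : R) (v : circle R -> R) : mu.-integrable setT (EFin \o v) ->
    mu.-integrable setT (EFin \o (fun z => c * v z)).
  exact: (integrableZl measurableT c).
have iu : mu.-integrable setT (EFin \o u).
  exact: (integrableD measurableT (iZ _ _ hr) (iZ _ _ hr')).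
pose w z := 2 * s * n z - u z.
have iw : mu.-integrable setT (EFin \o w).
  exact: (integrableB measurableT (iZ _ _ in0) iu).
have mw : measurable_fun setT w by apply/measurable_EFinP; exact: measurable_int iw.
(* Restricting to [h0 <> 0] makes [|f|^2 = 1_A] exact; where [h0 = 0] the claim
   is the nonnegativity of [h] and [h']. *)
pose A := [set z | 0 < w z] `&` [set z | 0 < n z].
have mA : measurable A.
  apply: measurableI.
    rewrite (_ : [set z | _] = setT `&` w @^-1` `]0, +oo[); first exact: mw.
    by rewrite setTI; apply/seteqP; split => z; rewrite /= in_itv/= andbT.
  rewrite (_ : [set z | _] = setT `&` n @^-1` `]0, +oo[); first exact: mn.
  by rewrite setTI; apply/seteqP; split => z; rewrite /= in_itv/= andbT.
have AT : A `<=` setT by [].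
have iA v := integrableS (mu := mu) (f := v) measurableT mA AT.
have LA := Linfty_indic mA.
pose f z := cindic A z * conj_sign h0 z.
pose g z := s%:C * cindic A z.
have Lf : Linfty f by apply: LinftyM => //; exact: Linfty_conj_sign.
have Lg : Linfty g by apply: LinftyM => //; exact: Linfty_cst.
have sC : Num.conj (s%:C : R[i]) = s%:C.
  by apply/eqP; rewrite eq_complex/= oppr0 !eqxx.
have conjM (x y : R[i]) : Num.conj (x * y) = Num.conj x * Num.conj y.
  exact: rmorphM.
have ffE z : (f z)^* * f z = cindic A z.
  rewrite /f conjM mulrACA cindic_idem conjc_mul_norm /cindic indicE.
  have [/set_mem[_ /= nz]|_] := boolP (z \in A); last by rewrite mul0r.
  rewrite conj_sign_norm ?expr1n ?mulr1//.
  by apply: contraTneq nz; rewrite /n => ->; rewrite normr0 ltxx.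
have ggE z : (g z)^* * g z = (s ^+ 2)%:C * cindic A z.
  by rewrite /g conjM sC mulrACA cindic_idem -rmorphM.
have gfE z : (g z)^* * f z * h0 z = s%:C * (cindic A z * `|h0 z|).
  rewrite /g /f conjM sC -(mulrA s%:C).
  rewrite (mulrA (Num.conj _)) cindic_idem.
  by rewrite -[LHS]mulrA -[X in _ * X]mulrA (conj_signM h0 z).
have Ln : L1 (fun z => `|h0 z|).
  have := L1M (Linfty_conj_sign mh0) Lh0.
  by under eq_fun do rewrite conj_signM.
have int_w : \int[mu]_(z in A) w z <= 0.
  have [+ _] := correlation_bound Lf Lg.
  rewrite h0E; last by apply: LinftyM => //; exact: Linfty_conj.
  under eq_fun do rewrite gfE.
  under [X in _ <= complex.Re (cintegral X) + _]eq_fun do rewrite ggE -mulrA.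
  under [X in _ <= _ + _ * complex.Re (cintegral X)]eq_fun do rewrite ffE.
  rewrite !cintegralZ; [|exact: L1M..].
  rewrite !cintegral_indic// !Re_mulc/= !mul0r !subr0 => le.
  rewrite RintegralB//; [|exact/iA/iZ|exact: iA].
  rewrite RintegralD//; [|exact/iA/iZ|exact/iA/iZ].
  rewrite !RintegralZl//; [|exact: iA..].
  rewrite subr_le0; apply: le_trans le; rewrite -mulrA mulr_natl lerMn2r//.
  by rewrite ler_norm.
have w0 : ae_eq mu A (EFin \o w) (cst 0%E).
  apply/(ae_eq_integral_abs mu mA); first exact: measurable_funS (measurable_int _ iw).
  rewrite (eq_integral (EFin \o w)); last first.
    by move=> z /set_mem[/= wz _]; rewrite gtr0_norm.
  apply/eqP; rewrite eq_le integral_ge0 ?andbT; last first.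
    by move=> z [/= /ltW wz _]; rewrite lee_fin.
  rewrite -[leLHS]fineK; last by apply: integrable_fin_num => //; exact: iA.
  by rewrite lee_fin.
apply: filterS3 w0 h_ge0 h'_ge0 => z wz hz hz'.
rewrite -/(n z) -/(u z) leNgt; apply/negP => uz.
have wz0 : 0 < w z by rewrite /w subr_gt0.
have [nz|nz] := ltP 0 (n z).
  by have := wz (conj wz0 nz) => -[] w00; rewrite w00 ltxx in wz0.
have nz0 : n z = 0.
  apply/eqP; rewrite eq_le nz -lecR RRe_real ?normr_real//; exact: normr_ge0.
move: uz; rewrite nz0 mulr0 ltNge addr_ge0// mulr_ge0 ?sqr_ge0//.
  by move: hz; rewrite lecE => /andP[].
by move: hz'; rewrite lecE => /andP[].
Qed.

(** Rational [s] suffice and leave a single null set; [q] enumerates them, with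
the value 0 at indices that encode no rational number. *)
Lemma density_bound h0 : L1 h0 ->
  (forall f, Linfty f -> correlation f = cintegral (fun z => f z * h0 z)) ->
  ae_le (cst 0) h -> ae_le (cst 0) h' ->
  \forall z \ae mu, `|h0 z| ^+ 2 <= (opnorm S)%:C ^+ 2 * h z * h' z.
Proof.
move=> Lh0 h0E h_ge0 h'_ge0.
pose q k : R := if unpickle k is Some q then @ratr R q else 0.
have : \forall z \ae mu, forall k, 2 * q k * complex.Re `|h0 z| <=
    q k ^+ 2 * complex.Re (h z) + opnorm S ^+ 2 * complex.Re (h' z).
  by apply: ae_foralln => k; exact: density_scaled_bound.
apply: filterS3 h_ge0 h'_ge0 => z hz hz' Q.
have realE (x : R[i]) : 0 <= x -> x = (complex.Re x)%:C.
  by move=> x0; rewrite RRe_real// ger0_real.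
rewrite (realE (h z))// (realE (h' z))// (realE `|h0 z|)//.
rewrite -!rmorphXn -!rmorphM lecR -mulrA [X in _ <= X]mulrCA.
apply: rational_discriminant => [|p]; first by move: hz; rewrite lecE => /andP[].
by have := Q (pickle p); rewrite /q pickleK.
Qed.

End intertwiner.
End cyclic_representation.

Theorem theorem2p7 (R : realType) (N : nat) (hN : (2 <= N)%N)
  (m0 m0' h h' : circle R -> R[i])
  (m0_Linfty : Linfty m0) (m0_ns : nonsingular m0)
  (m0'_Linfty : Linfty m0') (m0'_ns : nonsingular m0')
  (h_L1 : L1 h) (h_ge0 : ae_le (cst 0) h)
  (h_fix : ruelle N m0 m0 h = h %[ae haar R])
  (h'_L1 : L1 h') (h'_ge0 : ae_le (cst 0) h')
  (h'_fix : ruelle N m0' m0' h' = h' %[ae haar R])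
  (H H' : hilbertType R)
  (pi : (circle R -> R[i]) -> {linear H -> H}) (U : unitary H) (phi : H)
  (pi' : (circle R -> R[i]) -> {linear H' -> H'}) (U' : unitary H') (phi' : H')
  (rep : is_cyclic_rep N m0 h pi U phi)
  (rep' : is_cyclic_rep N m0' h' pi' U' phi')
  (S : {linear H' -> H}) (S_bounded : bounded_op S)
  (S_pi : forall f, Linfty f -> forall x, S (pi' f x) = pi f (S x))
  (S_U : forall x, S (U' x) = U (S x)) :
  exists h0 : circle R -> R[i],
    [/\ L1 h0 /\
        (ruelle N m0 m0' h0 = h0 %[ae haar R] /\
         forall f, Linfty f ->
           ip phi (S (pi' f phi')) = cintegral (fun z => f z * h0 z)),
        forall h1 : circle R -> R[i], L1 h1 ->
          ruelle N m0 m0' h1 = h1 %[ae haar R] ->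
          (forall f, Linfty f ->
             ip phi (S (pi' f phi')) = cintegral (fun z => f z * h1 z)) ->
          h1 = h0 %[ae haar R]
      & \forall z \ae haar R,
          `|h0 z| ^+ 2 <= (opnorm S)%:C ^+ 2 * h z * h' z].
Proof.
have N0 : (0 < N)%N by exact: leq_trans hN.
have [h0 [Lh0 h0E]] := correlation_density h_L1 h'_L1 rep rep' S_bounded S_pi.
exists h0; split.
- split=> //; split; last exact: h0E.
  exact: (density_ruelle_fix N0 m0_Linfty m0'_Linfty rep rep' S_pi S_U).
- move=> h1 Lh1 _ h1E; apply: L1_ae_eq_indic => // A mA.
  have LA := Linfty_indic mA.
  by rewrite -h1E// -[RHS]h0E.
- exact: (density_bound h_L1 h'_L1 rep rep' S_bounded S_pi).
Qed.
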